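(* Let $\lambda\in\mathbb C\setminus\mathbb R$ satisfy the positive-cone Diophantine condition: there are constants $c>0$, $\delta>0$ such that \[ |\lambda m+n|>\frac{c}{(m+n)^\delta}\qquad\text{for all }(m,n)\in\mathbb N^2\setminus\{(0,0)\}, \] and let \[ \omega_0=\frac{dy}{y}-\lambda\frac{dx}{x}. \] Let $\eta$ be a germ of meromorphic $1$-form at $0\in\mathbb C^2$ such that $xy\,\eta$ is holomorphic. Then there are $\alpha,\beta\in\mathbb C$ and a meromorphic germ $h\in\mathcal M_2$ such that: (1) $xyh\in\mathcal O_2$; (2) $\left(\eta-\alpha\frac{dx}{x}-\beta\frac{dy}{y}\right)\wedge\omega_0=dh\wedge\omega_0$. In particular, there is $a\in\mathcal M_2$, with $xya\in\mathcal O_2$, such that \[ \eta=a\,\omega_0+\alpha\frac{dx}{x}+\beta\frac{dy}{y}+dh. \]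
   Context: $\mathcal O_2$ is the ring of germs of holomorphic functions at $0\in\mathbb C^2$ and $\mathcal M_2$ its field of fractions (germs of meromorphic functions at $0$). $(x,y)$ are the coordinates of $\mathbb C^2$. $\mathbb N=\{0,1,2,\dots\}$. *)

(* Defs.v *)
From Stdlib Require Export Reals.
From Coquelicot Require Export Coquelicot.

Open Scope C_scope.

Definition C2 : NormedModule C_AbsRing :=
  prod_NormedModule C_AbsRing C_NormedModule C_NormedModule.

Definition origin : C2 := (RtoC 0, RtoC 0).

(** A germ at the origin is represented by a total function [C2 -> C], and
    equality of germs is equality on some neighbourhood of the origin. *)
Definition germ_eq (f g : C2 -> C) : Prop :=
  locally origin (fun p => f p = g p).

(** Membership in O_2: Frechet complex-differentiability (the scalars being
    [C_AbsRing]) at every point of a neighbourhood of the origin. *)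
Definition holomorphic_germ (f : C2 -> C) : Prop :=
  locally origin
    (fun p => @ex_filterdiff C_AbsRing C2 C_NormedModule f (locally p)).

(** Complex partial derivatives.  [C_derive] is total; it is the derivative
    wherever that exists, hence near the origin for a holomorphic germ. *)
Definition partial_x (f : C2 -> C) : C2 -> C :=
  fun p => C_derive (fun z => f (z, snd p)) (fst p).
Definition partial_y (f : C2 -> C) : C2 -> C :=
  fun p => C_derive (fun w => f (fst p, w)) (snd p).

(** The field of fractions M_2 of O_2.  A formal fraction carries no proofs;
    it denotes an element of M_2 when it satisfies [meromorphic], and two such
    fractions denote the same element when they are related by [frac_eq]. *)
Record frac : Type := Frac { num : C2 -> C; den : C2 -> C }.

Definition meromorphic (F : frac) : Prop :=
  holomorphic_germ (num F) /\ holomorphic_germ (den F) /\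
  ~ germ_eq (den F) (fun _ => RtoC 0).

Definition frac_eq (F G : frac) : Prop :=
  germ_eq (fun p => num F p * den G p) (fun p => num G p * den F p).

Definition frac_of (f : C2 -> C) : frac := Frac f (fun _ => RtoC 1).

Definition frac_const (c : C) : frac := frac_of (fun _ => c).
Definition frac_x : frac := frac_of (fun p => fst p).
Definition frac_y : frac := frac_of (fun p => snd p).

Definition frac_add (F G : frac) : frac :=
  Frac (fun p => num F p * den G p + num G p * den F p)
       (fun p => den F p * den G p).
Definition frac_opp (F : frac) : frac := Frac (fun p => - num F p) (den F).
Definition frac_sub (F G : frac) : frac := frac_add F (frac_opp G).
Definition frac_mul (F G : frac) : frac :=
  Frac (fun p => num F p * num G p) (fun p => den F p * den G p).
(** Only used on nonzero fractions: the inverse of zero is not meromorphic. *)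
Definition frac_inv (F : frac) : frac := Frac (den F) (num F).

Definition frac_dx (F : frac) : frac :=
  Frac (fun p => partial_x (num F) p * den F p - num F p * partial_x (den F) p)
       (fun p => den F p * den F p).
Definition frac_dy (F : frac) : frac :=
  Frac (fun p => partial_y (num F) p * den F p - num F p * partial_y (den F) p)
       (fun p => den F p * den F p).

Definition in_O2 (F : frac) : Prop :=
  exists f : C2 -> C, holomorphic_germ f /\ frac_eq F (frac_of f).

(** The 1-form [coef_dx * dx + coef_dy * dy]. *)
Record mform : Type := MForm { coef_dx : frac; coef_dy : frac }.

Definition meromorphic_form (u : mform) : Prop :=
  meromorphic (coef_dx u) /\ meromorphic (coef_dy u).

Definition holomorphic_form (u : mform) : Prop :=
  in_O2 (coef_dx u) /\ in_O2 (coef_dy u).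

Definition form_eq (u v : mform) : Prop :=
  frac_eq (coef_dx u) (coef_dx v) /\ frac_eq (coef_dy u) (coef_dy v).

Definition form_add (u v : mform) : mform :=
  MForm (frac_add (coef_dx u) (coef_dx v)) (frac_add (coef_dy u) (coef_dy v)).
Definition form_sub (u v : mform) : mform :=
  MForm (frac_sub (coef_dx u) (coef_dx v)) (frac_sub (coef_dy u) (coef_dy v)).
Definition form_scal (F : frac) (u : mform) : mform :=
  MForm (frac_mul F (coef_dx u)) (frac_mul F (coef_dy u)).

Definition dlog_x : mform := MForm (frac_inv frac_x) (frac_const 0).
Definition dlog_y : mform := MForm (frac_const 0) (frac_inv frac_y).

Definition differential (F : frac) : mform := MForm (frac_dx F) (frac_dy F).

(** The 2-form [u /\ v], given by its coefficient on [dx /\ dy]. *)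
Definition wedge (u v : mform) : frac :=
  frac_sub (frac_mul (coef_dx u) (coef_dy v))
           (frac_mul (coef_dy u) (coef_dx v)).

Declare Scope frac_scope.
Delimit Scope frac_scope with frac.
Bind Scope frac_scope with frac.
Infix "*" := frac_mul : frac_scope.
Infix "==" := frac_eq (at level 70, no associativity) : frac_scope.

Declare Scope form_scope.
Delimit Scope form_scope with form.
Bind Scope form_scope with mform.
Infix "+" := form_add : form_scope.
Infix "-" := form_sub : form_scope.
Notation "F *: u" := (form_scal F u) (at level 40, left associativity)
  : form_scope.
Infix "==" := form_eq (at level 70, no associativity) : form_scope.

Definition omega0 (lambda : C) : mform :=
  (dlog_y - frac_const lambda *: dlog_x)%form.

Definition positive_cone_diophantine (lambda : C) : Prop :=
  exists c delta : R, (0 < c)%R /\ (0 < delta)%R /\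
    forall m n : nat, (m, n) <> (0%nat, 0%nat) ->
      (Cmod (lambda * RtoC (INR m) + RtoC (INR n))
        > c / Rpower (INR (m + n)) delta)%R.

(* Main.v *)
Require Import Defs.
From Stdlib Require Import Lra Lia Psatz.

(** Write [eta = A dx/(xy) + B dy/(xy)] with [A], [B] holomorphic and put
    [X = x d/dx + lambda y d/dy].  Wedging with [omega_0] turns a differential
    into a derivative along [X]: the 2-form [dh /\ omega_0] has coefficient
    [X h / (xy)], and [eta /\ omega_0] has coefficient [F / (xy)^2] with
    [F = x A + lambda y B].  Looking for [h = H / (xy)], and taking [beta = 0],
    the wedge equation becomes the Euler-type equation
      [X H - (1 + lambda) H = F - alpha x y].
    Monomials diagonalise it: [x^i y^j] is an eigenvector with eigenvalue
    [(i - 1) + lambda (j - 1)].  As [lambda] is not real, this eigenvalue is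
    zero only for [i = j = 1] and otherwise has modulus at least
    [min(1, |Im lambda|)] ([divisor_lower_bound]); so [alpha] is the
    coefficient of [xy] in [F], and dividing the other coefficients of [F] keeps
    them geometrically bounded, hence [H] converges ([euler_equation]).  The
    remaining multiple of [omega_0] is read off the [dy] component of the
    equation for [eta]: [a = (y B - y H_y + H) / (xy)].

    This rests on the fact that a germ which is complex differentiable
    at every point is the sum of a power series with
    geometrically bounded coefficients, and conversely.

    In one variable, let [w] run over the circle [|w| = r] and let [|a| < r].
    The closed form [h(z) dlog(z - a)], pulled back along
    [z = a + exp s (w - a)], has zero integral over the boundary of every
    rectangle in [(s, theta)], by Goursat's subdivision
    argument ([bisection_zero]); so its integral over [theta] does not depend on
    [s] ([angular_radius_invariant]), and [s -> -oo] gives Cauchy's formula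
    ([cauchy_vanishing]).  Expanding the kernel in a finite geometric series
    gives the Taylor polynomials with an explicit error ([taylor_error]).

    In two variables the Cauchy coefficient is taken in [y] and then in [x].
    The inner coefficients are Lipschitz in [x], which makes the outer integral
    meaningful, and the two error bounds combine to show that the square partial
    sums converge to the function ([square_sum_approx]).  Conversely, on a small
    polydisc the monomials satisfy a quadratic Taylor estimate with summable
    constants, which passes to the limit ([psum_second_order]) and makes the sum
    Frechet differentiable with the termwise partial derivatives. *)

Local Open Scope R_scope.

(** * Goursat subdivision *)

Section Bisection.
Variables (J : R -> R -> R -> R -> C) (A1 A2 B1 B2 : R).
Hypothesis HA : A1 <= A2.
Hypothesis HB : B1 <= B2.
Hypothesis add_s : forall s1 s s2 t1 t2, A1 <= s1 <= s -> s <= s2 <= A2 ->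
  B1 <= t1 <= t2 -> t2 <= B2 -> J s1 s2 t1 t2 = (J s1 s t1 t2 + J s s2 t1 t2)%C.
Hypothesis add_t : forall s1 s2 t1 t t2, A1 <= s1 <= s2 -> s2 <= A2 ->
  B1 <= t1 <= t -> t <= t2 <= B2 -> J s1 s2 t1 t2 = (J s1 s2 t1 t + J s1 s2 t t2)%C.

Let ds n := (A2 - A1) / 2 ^ n.
Let dt n := (B2 - B1) / 2 ^ n.

(** [J s1 s2 t1 t2] stands for an integral over the boundary of the rectangle
    [s1, s2] x [t1, t2]; [Q n p] is its modulus on the rectangle of the [n]-th
    generation with lower left corner [p]. *)
Let Q n (p : R * R) := Cmod (J (fst p) (fst p + ds n) (snd p) (snd p + dt n)).

(** By additivity one of the four quarters carries at least a quarter of [Q];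
    the first one that does is selected. *)
Definition quarter n (p : R * R) : R * R :=
  let (s, t) := p in
  if Rle_dec (Q n p) (4 * Q (S n) (s, t)) then (s, t)
  else if Rle_dec (Q n p) (4 * Q (S n) (s + ds (S n), t)) then (s + ds (S n), t)
  else if Rle_dec (Q n p) (4 * Q (S n) (s, t + dt (S n))) then (s, t + dt (S n))
  else (s + ds (S n), t + dt (S n)).

Fixpoint corner n : R * R :=
  match n with O => (A1, B1) | S m => quarter m (corner m) end.

Lemma ds_half n : ds n = ds (S n) + ds (S n).
Proof. unfold ds. simpl. field. apply pow_nonzero. lra. Qed.

Lemma dt_half n : dt n = dt (S n) + dt (S n).
Proof. unfold dt. simpl. field. apply pow_nonzero. lra. Qed.

Lemma ds_pos n : 0 <= ds n.
Proof. unfold ds. apply Rmult_le_pos. lra. left. apply Rinv_0_lt_compat, pow_lt. lra. Qed.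

Lemma dt_pos n : 0 <= dt n.
Proof. unfold dt. apply Rmult_le_pos. lra. left. apply Rinv_0_lt_compat, pow_lt. lra. Qed.

Definition inside n (p : R * R) :=
  A1 <= fst p /\ fst p + ds n <= A2 /\ B1 <= snd p /\ snd p + dt n <= B2.

Lemma quarter_spec n p : inside n p ->
  inside (S n) (quarter n p) /\ Q n p <= 4 * Q (S n) (quarter n p) /\
  fst p <= fst (quarter n p) /\ fst (quarter n p) + ds (S n) <= fst p + ds n /\
  snd p <= snd (quarter n p) /\ snd (quarter n p) + dt (S n) <= snd p + dt n.
Proof.
destruct p as [s t]; intros (h1 & h2 & h3 & h4); simpl in *.
generalize (ds_half n) (dt_half n) (ds_pos (S n)) (dt_pos (S n)); intros ea eb pa pb.
assert (HQ : Q n (s, t) <= Q (S n) (s, t) + Q (S n) (s + ds (S n), t)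
   + Q (S n) (s, t + dt (S n)) + Q (S n) (s + ds (S n), t + dt (S n))).
{ unfold Q; cbn [fst snd].
  rewrite (add_s s (s + ds (S n)) (s + ds n)) by lra.
  rewrite (add_t s (s + ds (S n)) t (t + dt (S n)) (t + dt n)) by lra.
  rewrite (add_t (s + ds (S n)) (s + ds n) t (t + dt (S n)) (t + dt n)) by lra.
  replace (s + ds (S n) + ds (S n)) with (s + ds n) by lra.
  replace (t + dt (S n) + dt (S n)) with (t + dt n) by lra.
  eapply Rle_trans; [apply Cmod_triangle|].
  eapply Rle_trans; [apply Rplus_le_compat; apply Cmod_triangle|]. lra. }
unfold inside; cbn [quarter];
repeat match goal with |- context [Rle_dec ?x ?y] => destruct (Rle_dec x y) end;
  cbn [fst snd]; repeat split; lra.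
Qed.

Lemma corner_spec n : inside n (corner n) /\
  Cmod (J A1 A2 B1 B2) <= 4 ^ n * Q n (corner n).
Proof.
induction n as [|n [IH1 IH2]].
- unfold inside, Q, ds, dt; cbn [corner fst snd pow].
  replace (A1 + (A2 - A1) / 1) with A2 by field.
  replace (B1 + (B2 - B1) / 1) with B2 by field.
  repeat split; lra.
- destruct (quarter_spec n _ IH1) as (q1 & q2 & _).
  split; [exact q1|]. cbn [corner].
  eapply Rle_trans; [exact IH2|]. simpl.
  assert (0 < 4 ^ n) by (apply pow_lt; lra). nra.
Qed.

Lemma corner_mono n k :
  fst (corner n) <= fst (corner (n + k)) /\
  fst (corner (n + k)) + ds (n + k) <= fst (corner n) + ds n /\
  snd (corner n) <= snd (corner (n + k)) /\
  snd (corner (n + k)) + dt (n + k) <= snd (corner n) + dt n.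
Proof.
induction k as [|k IH].
- replace (n + 0)%nat with n by lia. repeat split; lra.
- replace (n + S k)%nat with (S (n + k)) by lia.
  destruct (quarter_spec (n + k) _ (proj1 (corner_spec _))) as (_ & _ & q).
  cbn [corner]. repeat split; lra.
Qed.

Lemma corner_limit : exists s t, forall n,
  fst (corner n) <= s <= fst (corner n) + ds n /\
  snd (corner n) <= t <= snd (corner n) + dt n.
Proof.
assert (cross : forall m n, fst (corner m) <= fst (corner n) + ds n /\
                            snd (corner m) <= snd (corner n) + dt n).
{ intros m n. destruct (Nat.le_ge_cases m n) as [h|h].
  - destruct (corner_mono m (n - m)) as (h1 & _ & h3 & _).
    replace (m + (n - m))%nat with n in * by lia.
    generalize (ds_pos n) (dt_pos n); lra.
  - destruct (corner_mono n (m - n)) as (_ & h2 & _ & h4).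
    replace (n + (m - n))%nat with m in * by lia.
    generalize (ds_pos m) (dt_pos m); lra. }
destruct (completeness (fun x => exists n, x = fst (corner n))) as [s [s1 s2]].
{ exists (fst (corner 0) + ds 0). intros x [n ->]. apply cross. }
{ exists (fst (corner 0)), 0%nat. reflexivity. }
destruct (completeness (fun x => exists n, x = snd (corner n))) as [t [t1 t2]].
{ exists (snd (corner 0) + dt 0). intros x [n ->]. apply cross. }
{ exists (snd (corner 0)), 0%nat. reflexivity. }
exists s, t. intros n. repeat split.
- apply s1. now exists n.
- apply s2. intros x [m ->]. apply cross.
- apply t1. now exists n.
- apply t2. intros x [m ->]. apply cross.
Qed.

Hypothesis local_small : forall s0 t0 eps, A1 <= s0 <= A2 -> B1 <= t0 <= B2 -> 0 < eps ->
  exists delta, 0 < delta /\ forall s1 s2 t1 t2,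
    A1 <= s1 <= s0 -> s0 <= s2 <= A2 -> B1 <= t1 <= t0 -> t0 <= t2 <= B2 ->
    s2 - s1 < delta -> t2 - t1 < delta ->
    Cmod (J s1 s2 t1 t2) <= eps * ((s2 - s1) + (t2 - t1)) ^ 2.

(** Along nested rectangles [J] decays at most by a factor 4 per generation,
    as fast as the square of the diameter; near the common limit point it must
    decay strictly faster, so [J] can only start from zero. *)
Lemma bisection_zero : J A1 A2 B1 B2 = RtoC 0.
Proof.
apply Cmod_eq_0.
destruct (Rle_lt_or_eq_dec 0 _ (Cmod_ge_0 (J A1 A2 B1 B2))) as [Hpos|H0]; [exfalso|auto].
destruct corner_limit as (s & t & lim).
set (D := (A2 - A1) + (B2 - B1)).
assert (HD : 0 < D ^ 2 + 1) by nra.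
set (eps := Cmod (J A1 A2 B1 B2) / (2 * (D ^ 2 + 1))).
assert (He : 0 < eps) by (apply Rdiv_lt_0_compat; lra).
destruct (local_small s t eps) as (d & Hd & loc); try assumption.
{ destruct (lim 0%nat) as [h _]; destruct (corner_spec 0) as [(i1 & i2 & _) _]. lra. }
{ destruct (lim 0%nat) as [_ h]; destruct (corner_spec 0) as [(_ & _ & i1 & i2) _]. lra. }
destruct (pow_lt_1_zero (/ 2)) with (y := d / (D + 1)) as [N HN].
{ rewrite Rabs_pos_eq; lra. }
{ apply Rdiv_lt_0_compat; unfold D in *; lra. }
specialize (HN N (le_n _)).
assert (p2 : 0 < / 2 ^ N) by (apply Rinv_0_lt_compat, pow_lt; lra).
rewrite pow_inv, Rabs_pos_eq in HN by lra.
(* The generation [N] whose rectangles have sides shorter than [d]. *)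
assert (HN' : D * / 2 ^ N < d).
{ apply Rle_lt_trans with ((D + 1) * / 2 ^ N); [nra|].
  apply Rmult_lt_reg_l with (/ (D + 1)); [apply Rinv_0_lt_compat; unfold D; lra|].
  replace (/ (D + 1) * ((D + 1) * / 2 ^ N)) with (/ 2 ^ N) by (field; split; [apply pow_nonzero; lra|unfold D; lra]).
  rewrite Rmult_comm. exact HN. }
destruct (corner_spec N) as [(i1 & i2 & i3 & i4) big].
destruct (lim N) as [ls lt'].
assert (ea : ds N = (A2 - A1) * / 2 ^ N) by reflexivity.
assert (eb : dt N = (B2 - B1) * / 2 ^ N) by reflexivity.
assert (small := loc (fst (corner N)) (fst (corner N) + ds N) (snd (corner N)) (snd (corner N) + dt N)).
assert (small' : Q N (corner N) <= eps * (ds N + dt N) ^ 2).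
{ unfold Q. replace (ds N + dt N) with
   (fst (corner N) + ds N - fst (corner N) + (snd (corner N) + dt N - snd (corner N))) by ring.
  apply small; try lra; unfold D in HN'; nra. }
replace (ds N + dt N) with (D * / 2 ^ N) in small' by (rewrite ea, eb; unfold D; ring).
assert (e4 : 4 ^ N = 2 ^ N * 2 ^ N) by (rewrite <- Rpow_mult_distr; f_equal; lra).
assert (Cmod (J A1 A2 B1 B2) <= eps * D ^ 2).
{ eapply Rle_trans; [exact big|].
  eapply Rle_trans; [apply Rmult_le_compat_l; [apply pow_le; lra|exact small']|].
  rewrite e4. right. field. apply pow_nonzero; lra. }
assert (eps * (2 * (D ^ 2 + 1)) = Cmod (J A1 A2 B1 B2)) by (unfold eps; field; lra).
nra.
Qed.
End Bisection.

(** * Calculus of complex functions of a real variable *)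

Local Notation ccont f t := (@continuous R_UniformSpace C_UniformSpace f t).
Local Notation cderiv f t l := (@is_derive R_AbsRing C_R_NormedModule f t l).
Local Notation CInt f u v := (@RInt C_R_CompleteNormedModule f u v).
Local Notation is_CInt f u v l := (@is_RInt C_R_NormedModule f u v l).

Lemma sqrt2_le_2 : sqrt 2 <= 2.
Proof. rewrite <- (sqrt_square 2) at 2 by lra. apply sqrt_le_1_alt; lra. Qed.

(** The topology of [C] is generated by products of real intervals, the
    estimates below are in terms of [Cmod]; this lemma translates once. *)
Lemma ccont_eps (f : R -> C) t : ccont f t <->
  forall e, 0 < e -> exists d, 0 < d /\ forall u, Rabs (u - t) < d -> Cmod (f u - f t) < e.
Proof.
split.
- intros H e He.
  destruct (proj1 (filterlim_locally _ _) H (mkposreal (e / 2) ltac:(lra))) as [d Hd].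
  exists d. split; [apply cond_pos|]. intros u Hu.
  specialize (Hd u Hu).
  assert (h := C_NormedModule_mixin_compat2 (f t) (f u) _ Hd).
  eapply Rlt_le_trans; [exact h|]. simpl.
  assert (E := sqrt2_le_2).
  nra.
- intros H. apply filterlim_locally. intros e.
  destruct (H e (cond_pos e)) as (d & Hd & Hf).
  exists (mkposreal d Hd). intros u Hu. apply C_NormedModule_mixin_compat1.
  apply Hf, Hu.
Qed.

Lemma ccont_const (c : C) t : ccont (fun _ => c) t.
Proof. apply continuous_const. Qed.

Lemma ccont_plus (f g : R -> C) t : ccont f t -> ccont g t -> ccont (fun u => (f u + g u)%C) t.
Proof. intros Hf Hg. exact (@continuous_plus _ R_AbsRing C_R_NormedModule f g t Hf Hg). Qed.

Lemma ccont_minus (f g : R -> C) t : ccont f t -> ccont g t -> ccont (fun u => (f u - g u)%C) t.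
Proof. intros Hf Hg. exact (@continuous_minus _ R_AbsRing C_R_NormedModule f g t Hf Hg). Qed.

Lemma ccont_mult (f g : R -> C) t : ccont f t -> ccont g t -> ccont (fun u => (f u * g u)%C) t.
Proof.
rewrite !ccont_eps. intros Hf Hg e He.
set (Mf := Cmod (f t) + 1). set (Mg := Cmod (g t) + 1).
assert (1 <= Mf) by (generalize (Cmod_ge_0 (f t)); unfold Mf; lra).
assert (1 <= Mg) by (generalize (Cmod_ge_0 (g t)); unfold Mg; lra).
destruct (Hf (Rmin 1 (e / (2 * Mg)))) as (d1 & Hd1 & H1).
{ apply Rmin_pos; [lra|apply Rdiv_lt_0_compat; lra]. }
destruct (Hg (e / (2 * Mf))) as (d2 & Hd2 & H2).
{ apply Rdiv_lt_0_compat; lra. }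
exists (Rmin d1 d2). split; [now apply Rmin_pos|]. intros u Hu.
specialize (H1 u (Rlt_le_trans _ _ _ Hu (Rmin_l _ _))).
specialize (H2 u (Rlt_le_trans _ _ _ Hu (Rmin_r _ _))).
replace (f u * g u - f t * g t)%C with (f u * (g u - g t) + (f u - f t) * g t)%C by ring.
eapply Rle_lt_trans; [apply Cmod_triangle|]. rewrite !Cmod_mult.
assert (Cmod (f u) <= Mf).
{ replace (f u) with ((f u - f t) + f t)%C by ring.
  eapply Rle_trans; [apply Cmod_triangle|]. unfold Mf.
  generalize (Rmin_l 1 (e / (2 * Mg))); lra. }
assert (Cmod (f u) * Cmod (g u - g t) <= Mf * Cmod (g u - g t))
  by (apply Rmult_le_compat_r; [apply Cmod_ge_0|assumption]).
assert (Mf * Cmod (g u - g t) < e / 2).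
{ replace (e / 2) with (Mf * (e / (2 * Mf))) by (field; lra). apply Rmult_lt_compat_l; lra. }
assert (Cmod (f u - f t) * Cmod (g t) <= e / 2).
{ replace (e / 2) with (e / (2 * Mg) * Mg) by (field; lra).
  apply Rmult_le_compat; try apply Cmod_ge_0.
  - generalize (Rmin_r 1 (e / (2 * Mg))); lra.
  - unfold Mg; lra. }
lra.
Qed.

Lemma ccont_inv (f : R -> C) t : ccont f t -> f t <> RtoC 0 -> ccont (fun u => (/ f u)%C) t.
Proof.
rewrite !ccont_eps. intros Hf H0 e He.
assert (Hm := proj1 (Cmod_gt_0 _) H0). set (m := Cmod (f t)) in *.
destruct (Hf (Rmin (m / 2) (e * (m * m / 2)))) as (d & Hd & H).
{ apply Rmin_pos; [lra|apply Rmult_lt_0_compat; [lra|nra]]. }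
exists d. split; [assumption|]. intros u Hu. specialize (H u Hu).
assert (Hu2 : m / 2 < Cmod (f u)).
{ assert (m <= Cmod (f u) + Cmod (f u - f t)).
  { unfold m. replace (f t) with (f u + - (f u - f t))%C at 1 by ring.
    eapply Rle_trans; [apply Cmod_triangle|]. rewrite Cmod_opp. lra. }
  generalize (Rmin_l (m / 2) (e * (m * m / 2))); lra. }
assert (Hu0 : f u <> 0%C) by (apply Cmod_gt_0; lra).
replace (/ f u - / f t)%C with (- ((f u - f t) * / (f u * f t)))%C by (field; auto).
rewrite Cmod_opp, Cmod_mult, Cmod_inv by (now apply Cmult_neq_0).
rewrite Cmod_mult. fold m.
assert (0 < Cmod (f u) * m) by nra.
apply Rmult_lt_reg_r with (Cmod (f u) * m); [assumption|].
rewrite Rmult_assoc, Rinv_l, Rmult_1_r by lra.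
eapply Rlt_le_trans; [exact H|]. eapply Rle_trans; [apply Rmin_r|].
apply Rmult_le_compat_l; [lra|]. nra.
Qed.

Lemma cderiv_pair (u v : R -> R) t lu lv :
  is_derive u t lu -> is_derive v t lv -> cderiv (fun s => (u s, v s)) t (lu, lv).
Proof.
intros Hu Hv.
apply (@filterdiff_comp_2 R_AbsRing R_NormedModule R_NormedModule R_NormedModule C_R_NormedModule
  (locally t) _ u v (fun x y => (x, y)) (fun y => scal y lu) (fun y => scal y lv) (fun x y => (x, y)) Hu Hv).
apply filterdiff_ext with (f := fun z => z); [intros [x y]; reflexivity|].
apply filterdiff_ext_lin with (fun z => z); [|intros [x y]; reflexivity].
apply filterdiff_id.
Qed.

Lemma is_linear_Cmult (c : C) :
  @is_linear R_AbsRing C_R_NormedModule C_R_NormedModule (fun z => (c * z)%C).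
Proof.
split.
- intros x y. apply injective_projections; simpl; unfold plus; simpl; ring.
- intros k x. apply injective_projections; simpl; unfold scal; simpl; unfold mult; simpl; ring.
- exists (Cmod c + 1). split; [generalize (Cmod_ge_0 c); lra|]. intros x.
  rewrite <- !Cmod_norm, Cmod_mult.
  generalize (Cmod_ge_0 x); lra.
Qed.

Lemma cderiv_Cmult (c : C) (f : R -> C) t l : cderiv f t l -> cderiv (fun s => (c * f s)%C) t (c * l)%C.
Proof.
intros H. unfold is_derive.
apply filterdiff_ext_lin with (fun y : R => (c * scal y l)%C).
- apply (filterdiff_comp' (U := R_NormedModule) (V := C_R_NormedModule) (W := C_R_NormedModule)
    f (fun z => (c * z)%C) t (fun y => scal y l) (fun z => (c * z)%C) H).
  apply filterdiff_linear, is_linear_Cmult.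
- intros y. apply (linear_scal _ (is_linear_Cmult c)).
Qed.

Lemma cderiv_cont (f : R -> C) t l : cderiv f t l -> ccont f t.
Proof. intros H. apply (@ex_derive_continuous R_AbsRing C_R_NormedModule). now exists l. Qed.

Lemma ccont_CInt (f : R -> C) u v : (forall t, Rmin u v <= t <= Rmax u v -> ccont f t) ->
  is_CInt f u v (CInt f u v).
Proof. intros H. apply (@RInt_correct C_R_CompleteNormedModule), (@ex_RInt_continuous C_R_CompleteNormedModule), H. Qed.

Lemma CInt_le (f : R -> C) u v l M : u <= v -> (forall t, u <= t <= v -> Cmod (f t) <= M) ->
  is_CInt f u v l -> Cmod l <= (v - u) * M.
Proof.
intros Huv HM HI. rewrite Cmod_norm.
apply (@norm_RInt_le_const C_R_NormedModule f u v l M Huv); [|exact HI].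
intros x Hx. rewrite <- Cmod_norm. auto.
Qed.

(** [C] is here a real normed module, so linearity over [C] has to be checked
    on real and imaginary parts. *)
Lemma is_CInt_Cmult (c : C) (f : R -> C) u v l : is_CInt f u v l -> is_CInt (fun t => (c * f t)%C) u v (c * l)%C.
Proof.
intros H.
assert (H1 := is_RInt_fct_extend_fst _ _ _ _ H).
assert (H2 := is_RInt_fct_extend_snd _ _ _ _ H).
apply (@is_RInt_fct_extend_pair R_NormedModule R_NormedModule); simpl.
- exact (is_RInt_minus _ _ _ _ _ _ (is_RInt_scal _ _ _ (fst c) _ H1) (is_RInt_scal _ _ _ (snd c) _ H2)).
- exact (is_RInt_plus _ _ _ _ _ _ (is_RInt_scal _ _ _ (fst c) _ H2) (is_RInt_scal _ _ _ (snd c) _ H1)).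
Qed.

Lemma is_CInt_minus (f g : R -> C) u v lf lg : is_CInt f u v lf -> is_CInt g u v lg ->
  is_CInt (fun t => (f t - g t)%C) u v (lf - lg)%C.
Proof. intros Hf Hg. exact (is_RInt_minus _ _ _ _ _ _ Hf Hg). Qed.

Lemma is_CInt_plus (f g : R -> C) u v lf lg : is_CInt f u v lf -> is_CInt g u v lg ->
  is_CInt (fun t => (f t + g t)%C) u v (lf + lg)%C.
Proof. intros Hf Hg. exact (is_RInt_plus _ _ _ _ _ _ Hf Hg). Qed.

Lemma is_CInt_unique (f : R -> C) u v l : is_CInt f u v l -> CInt f u v = l.
Proof. apply (@is_RInt_unique C_R_CompleteNormedModule). Qed.

(** The local estimate in Goursat's argument compares an integrand with an
    exact one, whose integral telescopes around the rectangle. *)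
Lemma CInt_near_exact (f P p : R -> C) u v eta : u <= v ->
  (forall t, u <= t <= v -> ccont f t) ->
  (forall t, u <= t <= v -> cderiv P t (p t)) ->
  (forall t, u <= t <= v -> ccont p t) ->
  (forall t, u <= t <= v -> Cmod (f t - p t) <= eta) ->
  Cmod (CInt f u v - (P v - P u)) <= (v - u) * eta.
Proof.
intros Huv Hf HP Hp Hfp.
apply CInt_le with (f := fun t => (f t - p t)%C); try assumption.
apply is_CInt_minus.
- apply ccont_CInt. rewrite Rmin_left, Rmax_right by assumption. exact Hf.
- apply (@is_RInt_derive C_R_CompleteNormedModule); rewrite Rmin_left, Rmax_right by assumption; assumption.
Qed.

Lemma cderiv_const (c : C) t : cderiv (fun _ => c) t (RtoC 0).
Proof. exact (@is_derive_const R_AbsRing C_R_NormedModule c t). Qed.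

Lemma cderiv_plus (f g : R -> C) t lf lg : cderiv f t lf -> cderiv g t lg ->
  cderiv (fun s => (f s + g s)%C) t (lf + lg)%C.
Proof. exact (@is_derive_plus R_AbsRing C_R_NormedModule f g t lf lg). Qed.

Lemma cderiv_minus (f g : R -> C) t lf lg : cderiv f t lf -> cderiv g t lg ->
  cderiv (fun s => (f s - g s)%C) t (lf - lg)%C.
Proof. exact (@is_derive_minus R_AbsRing C_R_NormedModule f g t lf lg). Qed.

Lemma is_CInt_Chasles (f : R -> C) u v x l1 l2 : is_CInt f u v l1 -> is_CInt f v x l2 ->
  is_CInt f u x (l1 + l2)%C.
Proof. apply (@is_RInt_Chasles C_R_NormedModule). Qed.

Lemma is_CInt_ext (f g : R -> C) u v l : (forall t, f t = g t) -> is_CInt f u v l -> is_CInt g u v l.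
Proof. intros H. apply (@is_RInt_ext C_R_NormedModule). auto. Qed.

(** * Radial homotopy of a circle to a point *)

(** Complex differentiability in an epsilon-delta form free of filters and of
    the choice of a module structure on [C]. *)
Definition cdiff (g : C -> C) (z l : C) : Prop :=
  forall e, 0 < e -> exists d, 0 < d /\ forall u : C, Cmod (u - z) < d ->
    Cmod (g u - g z - l * (u - z)) <= e * Cmod (u - z).

Lemma cdiff_continuous (h : C -> C) z l : cdiff h z l ->
  forall e, 0 < e -> exists d, 0 < d /\ forall u : C, Cmod (u - z) < d -> Cmod (h u - h z) < e.
Proof.
intros H e He. destruct (H 1) as (d & Hd & Hu); [lra|].
assert (Hl := Cmod_ge_0 l).
exists (Rmin d (e / (Cmod l + 1))). split.
{ apply Rmin_pos; [assumption|apply Rdiv_lt_0_compat; lra]. }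
intros u Hu'. specialize (Hu u (Rlt_le_trans _ _ _ Hu' (Rmin_l _ _))).
assert (Hu2 := Rlt_le_trans _ _ _ Hu' (Rmin_r _ _)).
replace (h u - h z)%C with ((h u - h z - l * (u - z)) + l * (u - z))%C by ring.
eapply Rle_lt_trans; [apply Cmod_triangle|]. rewrite Cmod_mult.
replace e with ((Cmod l + 1) * (e / (Cmod l + 1))) by (field; lra).
generalize (Cmod_ge_0 (u - z)); nra.
Qed.

Lemma ccont_comp (h : C -> C) (f : R -> C) t l : cdiff h (f t) l -> ccont f t -> ccont (fun u => h (f u)) t.
Proof.
rewrite !ccont_eps. intros Hh Hf e He.
destruct (cdiff_continuous _ _ _ Hh e He) as (d & Hd & H).
destruct (Hf d Hd) as (d' & Hd' & H'). exists d'. auto.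
Qed.

Definition circle (r t : R) : C := (r * cos t, r * sin t).

Lemma cderiv_circle r t : cderiv (circle r) t (Ci * circle r t)%C.
Proof.
replace (Ci * circle r t)%C with (- (r * sin t), r * cos t)
  by (unfold circle, Ci, Cmult; simpl; f_equal; ring).
apply cderiv_pair; auto_derive; trivial; ring.
Qed.

Lemma ccont_circle r t : ccont (circle r) t.
Proof. eapply cderiv_cont, cderiv_circle. Qed.

Lemma Cmod_circle r t : 0 <= r -> Cmod (circle r t) = r.
Proof.
intros Hr. unfold Cmod, circle; simpl.
replace (r * cos t * (r * cos t * 1) + r * sin t * (r * sin t * 1)) with
  (r * r * (Rsqr (sin t) + Rsqr (cos t))) by (unfold Rsqr; ring).
rewrite sin2_cos2, Rmult_1_r. now apply sqrt_square.
Qed.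

Lemma circle_lipschitz r t u : 0 <= r -> Cmod (circle r t - circle r u) <= 2 * r * Rabs (t - u).
Proof.
intros Hr.
assert (Hd : forall x y, Rabs (cos x - cos y) <= Rabs (x - y) /\ Rabs (sin x - sin y) <= Rabs (x - y)).
{ intros x y. rewrite <- (Rmult_1_l (Rabs (x - y))). split.
  - apply (bounded_variation cos (fun t => - sin t)).
    intros z _. split; [auto_derive; [trivial|ring]|]. rewrite Rabs_Ropp.
    apply Rabs_le. generalize (SIN_bound z); lra.
  - apply (bounded_variation sin cos).
    intros z _. split; [auto_derive; [trivial|ring]|].
    apply Rabs_le. generalize (COS_bound z); lra. }
eapply Rle_trans; [apply Cmod_2Rmax|]. unfold circle; simpl.
destruct (Hd t u) as [h1 h2].
assert (E := sqrt2_le_2).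
assert (Rmax (Rabs (r * cos t + - (r * cos u))) (Rabs (r * sin t + - (r * sin u))) <= r * Rabs (t - u)).
{ apply Rmax_lub.
  - replace (r * cos t + - (r * cos u)) with (r * (cos t - cos u)) by ring.
    rewrite Rabs_mult, (Rabs_pos_eq r) by assumption. now apply Rmult_le_compat_l.
  - replace (r * sin t + - (r * sin u)) with (r * (sin t - sin u)) by ring.
    rewrite Rabs_mult, (Rabs_pos_eq r) by assumption. now apply Rmult_le_compat_l. }
assert (0 <= sqrt 2) by apply sqrt_pos.
assert (0 <= r * Rabs (t - u)) by (apply Rmult_le_pos; [assumption|apply Rabs_pos]).
eapply Rle_trans; [apply Rmult_le_compat_l; eassumption|]. nra.
Qed.

Lemma circle_2PI r : circle r (2 * PI) = circle r 0.
Proof. unfold circle. now rewrite cos_2PI, sin_2PI, cos_0, sin_0. Qed.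

Lemma exp_le_1 x : x <= 0 -> exp x <= 1.
Proof. rewrite <- exp_0. intros [H| ->]; [left; now apply exp_increasing|lra]. Qed.

Lemma exp_lipschitz x y : x <= 0 -> y <= 0 -> Rabs (exp x - exp y) <= Rabs (x - y).
Proof.
assert (H : forall x y, y <= x -> x <= 0 -> exp x - exp y <= x - y).
{ intros u v h1 h2. replace v with (u + (v - u)) at 1 by ring. rewrite exp_plus.
  assert (E := exp_ineq1_le (v - u)). assert (0 < exp u) by apply exp_pos.
  assert (E1 := exp_le_1 u h2).
  nra. }
assert (M : forall x y, y <= x -> exp y <= exp x).
{ intros u v [h| ->]; [left; now apply exp_increasing|lra]. }
intros h1 h2. destruct (Rle_dec y x) as [h|h].
- rewrite !Rabs_pos_eq; [auto|lra|generalize (M x y h); lra].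
- rewrite <- (Rabs_Ropp (exp x - exp y)), <- (Rabs_Ropp (x - y)).
  rewrite !Rabs_pos_eq; [|lra|generalize (M y x ltac:(lra)); lra].
  generalize (H y x ltac:(lra) h2); lra.
Qed.

Section Radial.
Variables (a : C) (r : R).
Hypothesis Har : Cmod a < r.

Lemma r_pos : 0 < r.
Proof. generalize (Cmod_ge_0 a); lra. Qed.

(** The pullback of [dz / (z - a)] to the angle [t] of the circle. *)
Definition cauchy_kernel (t : R) : C := (Ci * circle r t / (circle r t - a))%C.

(** The exponential makes the pullback of [dz / (z - a)] along [radial] equal to
    [ds + cauchy_kernel dt], which has no singularity although the circle is
    contracted to [a] as [s -> -oo]. *)
Definition radial (s t : R) : C := (a + RtoC (exp s) * (circle r t - a))%C.

Lemma circle_far t : r - Cmod a <= Cmod (circle r t - a).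
Proof.
assert (H := Cmod_triangle (circle r t - a) a).
replace (circle r t - a + a)%C with (circle r t) in H by ring.
rewrite Cmod_circle in H; generalize r_pos; lra.
Qed.

Lemma circle_minus_neq t : (circle r t - a)%C <> RtoC 0.
Proof. apply Cmod_gt_0. generalize (circle_far t); lra. Qed.

Lemma circle_near t : Cmod (circle r t - a) <= 2 * r.
Proof.
eapply Rle_trans; [apply Cmod_triangle|]. rewrite Cmod_opp, Cmod_circle; generalize r_pos; lra.
Qed.

Lemma Cmod_cauchy_kernel t : Cmod (cauchy_kernel t) <= r / (r - Cmod a).
Proof.
unfold cauchy_kernel. rewrite Cmod_div by apply circle_minus_neq.
rewrite Cmod_mult, Cmod_Ci, Cmod_circle, Rmult_1_l by (generalize r_pos; lra).
apply Rmult_le_compat_l; [generalize r_pos; lra|].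
apply Rinv_le_contravar; [lra|apply circle_far].
Qed.

Lemma ccont_cauchy_kernel t : ccont cauchy_kernel t.
Proof.
apply ccont_mult; [apply ccont_mult; [apply ccont_const|apply ccont_circle]|].
apply (ccont_inv (fun t => circle r t - a)%C); [|apply circle_minus_neq].
apply ccont_minus; [apply ccont_circle|apply ccont_const].
Qed.

Lemma cderiv_radial_t s t : cderiv (radial s) t ((radial s t - a) * cauchy_kernel t)%C.
Proof.
assert (E : ((radial s t - a) * cauchy_kernel t = 0 + RtoC (exp s) * (Ci * circle r t - 0))%C).
{ unfold radial, cauchy_kernel. field. apply circle_minus_neq. }
rewrite E.
apply (cderiv_plus (fun _ => a)); [apply cderiv_const|].
apply cderiv_Cmult.
apply (cderiv_minus (circle r) (fun _ => a)).
- apply cderiv_circle.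
- apply cderiv_const.
Qed.

Lemma cderiv_radial_s s t : cderiv (fun s => radial s t) s (radial s t - a)%C.
Proof.
apply is_derive_ext with
  (fun s => (fst a + exp s * (r * cos t - fst a), snd a + exp s * (r * sin t - snd a))).
{ intros x. apply injective_projections; unfold radial, circle; simpl; ring. }
replace (radial s t - a)%C with (exp s * (r * cos t - fst a), exp s * (r * sin t - snd a)).
2:{ apply injective_projections; unfold radial, circle; simpl; ring. }
apply cderiv_pair; auto_derive; trivial; ring.
Qed.

Lemma ccont_radial_t s t : ccont (radial s) t.
Proof. eapply cderiv_cont, cderiv_radial_t. Qed.

Lemma ccont_radial_s s t : ccont (fun s => radial s t) s.
Proof. eapply cderiv_cont, cderiv_radial_s. Qed.

Lemma radial_lipschitz s t s0 t0 : s <= 0 -> s0 <= 0 ->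
  Cmod (radial s t - radial s0 t0) <= 2 * r * (Rabs (s - s0) + Rabs (t - t0)).
Proof.
intros Hs Hs0. assert (Hr := r_pos).
replace (radial s t - radial s0 t0)%C with
  (RtoC (exp s) * (circle r t - circle r t0) + RtoC (exp s - exp s0) * (circle r t0 - a))%C
  by (unfold radial; rewrite RtoC_minus; ring).
eapply Rle_trans; [apply Cmod_triangle|]. rewrite !Cmod_mult, !Cmod_R.
assert (h1 := circle_lipschitz r t t0 ltac:(lra)).
assert (h2 := circle_near t0). assert (h3 := exp_lipschitz s s0 Hs Hs0).
assert (E1 := exp_le_1 s Hs).
rewrite (Rabs_pos_eq (exp s)) by (left; apply exp_pos).
assert (0 < exp s) by apply exp_pos.
assert (exp s * Cmod (circle r t - circle r t0) <= 1 * (2 * r * Rabs (t - t0)))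
  by (apply Rmult_le_compat; try lra; apply Cmod_ge_0).
assert (Rabs (exp s - exp s0) * Cmod (circle r t0 - a) <= Rabs (s - s0) * (2 * r))
  by (apply Rmult_le_compat; try lra; [apply Rabs_pos|apply Cmod_ge_0]).
lra.
Qed.

Lemma Cmod_radial s t : s <= 0 -> Cmod (radial s t) <= r.
Proof.
intros Hs.
assert (E1 := exp_le_1 s Hs).
assert (0 < exp s) by apply exp_pos.
replace (radial s t) with (RtoC (1 - exp s) * a + RtoC (exp s) * circle r t)%C
  by (unfold radial; rewrite RtoC_minus; ring).
eapply Rle_trans; [apply Cmod_triangle|]. rewrite !Cmod_mult, !Cmod_R, !Rabs_pos_eq by lra.
rewrite Cmod_circle by (generalize r_pos; lra). nra.
Qed.

Variable h : C -> C.
Hypothesis Hh : forall z, Cmod z <= r -> exists l, cdiff h z l.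

Lemma ccont_h_t s t : s <= 0 -> ccont (fun t => h (radial s t)) t.
Proof.
intros Hs. destruct (Hh (radial s t) (Cmod_radial s t Hs)) as [l Hl].
eapply ccont_comp; [exact Hl|apply ccont_radial_t].
Qed.

Lemma ccont_h_s s t : s <= 0 -> ccont (fun s => h (radial s t)) s.
Proof.
intros Hs. destruct (Hh (radial s t) (Cmod_radial s t Hs)) as [l Hl].
eapply (ccont_comp h (fun s => radial s t)); [exact Hl|apply ccont_radial_s].
Qed.

(** The integrals of [h(z) dz / (z - a)] along the two families of coordinate
    lines of [radial]. *)
Definition angular s t1 t2 : C := CInt (fun t => (h (radial s t) * cauchy_kernel t)%C) t1 t2.

Definition axial t s1 s2 : C := CInt (fun s => h (radial s t)) s1 s2.

Lemma angular_is s t1 t2 : s <= 0 ->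
  is_CInt (fun t => (h (radial s t) * cauchy_kernel t)%C) t1 t2 (angular s t1 t2).
Proof.
intros Hs. apply ccont_CInt. intros t _.
apply ccont_mult; [now apply ccont_h_t|apply ccont_cauchy_kernel].
Qed.

Lemma axial_is t s1 s2 : s1 <= 0 -> s2 <= 0 ->
  is_CInt (fun s => h (radial s t)) s1 s2 (axial t s1 s2).
Proof.
intros h1 h2. apply ccont_CInt. intros s [_ Hs].
apply ccont_h_s. eapply Rle_trans; [exact Hs|]. now apply Rmax_lub.
Qed.

Definition kernel_primitive (t : R) : C := CInt cauchy_kernel 0 t.

Lemma cderiv_kernel_primitive t : cderiv kernel_primitive t (cauchy_kernel t).
Proof.
apply (@is_derive_RInt C_R_NormedModule cauchy_kernel kernel_primitive 0 t).
- apply filter_forall. intros b. apply ccont_CInt. intros; apply ccont_cauchy_kernel.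
- apply ccont_cauchy_kernel.
Qed.

(** The two axial sides of the rectangle [s0, 0] x [0, 2 pi] cancel by
    periodicity, so the statement is the vanishing of a boundary integral.  Only
    differentiability of [h] at each point is available, not continuity of the
    derivative, whence the subdivision. *)
Lemma angular_radius_invariant s0 : s0 <= 0 -> angular s0 0 (2 * PI) = angular 0 0 (2 * PI).
Proof.
intros Hs0. assert (Hr := r_pos). assert (HPI := PI_RGT_0).
set (J := fun s1 s2 t1 t2 => (angular s2 t1 t2 - angular s1 t1 t2 - (axial t2 s1 s2 - axial t1 s1 s2))%C).
assert (HJ : J s0 0 0 (2 * PI) = RtoC 0).
{ apply bisection_zero; try lra.
  - intros s1 s s2 t1 t2 H1 H2 H3 H4. unfold J.
    rewrite (is_CInt_unique _ _ _ _ (is_CInt_Chasles _ _ _ _ _ _ (axial_is t1 s1 s ltac:(lra) ltac:(lra)) (axial_is t1 s s2 ltac:(lra) ltac:(lra)))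
      : axial t1 s1 s2 = _).
    rewrite (is_CInt_unique _ _ _ _ (is_CInt_Chasles _ _ _ _ _ _ (axial_is t2 s1 s ltac:(lra) ltac:(lra)) (axial_is t2 s s2 ltac:(lra) ltac:(lra)))
      : axial t2 s1 s2 = _).
    ring.
  - intros s1 s2 t1 t t2 H1 H2 H3 H4. unfold J.
    rewrite (is_CInt_unique _ _ _ _ (is_CInt_Chasles _ _ _ _ _ _ (angular_is s1 t1 t ltac:(lra)) (angular_is s1 t t2 ltac:(lra)))
      : angular s1 t1 t2 = _).
    rewrite (is_CInt_unique _ _ _ _ (is_CInt_Chasles _ _ _ _ _ _ (angular_is s2 t1 t ltac:(lra)) (angular_is s2 t t2 ltac:(lra)))
      : angular s2 t1 t2 = _).
    ring.
  - intros u0 t0 eps Hu0 Ht0 Heps.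
    set (z0 := radial u0 t0).
    destruct (Hh z0 (Cmod_radial u0 t0 ltac:(lra))) as [l Hl].
    set (kap := r / (r - Cmod a)).
    assert (Hkap : 0 <= kap) by (apply Rmult_le_pos; [lra|left; apply Rinv_0_lt_compat; lra]).
    set (eta := eps / (4 * r * (kap + 1))).
    assert (Heta : 0 < eta) by (apply Rdiv_lt_0_compat; [lra|nra]).
    destruct (Hl eta Heta) as (d1 & Hd1 & Hloc).
    exists (d1 / (4 * r)). split; [apply Rdiv_lt_0_compat; lra|].
    intros s1 s2 t1 t2 Hs1 Hs2 Ht1 Ht2 Ds Dt.
    set (d := (s2 - s1) + (t2 - t1)).
    (* [h z0 + l (z - z0) = c0 + l (z - a)], and [Pi] is a primitive of
       [(c0 + l (z - a)) dz / (z - a)] in both variables. *)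
    set (c0 := (h z0 + l * (a - z0))%C).
    set (Pi := fun s t => (c0 * (RtoC s + kernel_primitive t) + l * radial s t)%C).
    assert (Hr4 : d1 / (4 * r) * (4 * r) = d1) by (field; lra).
    assert (Herr : forall s t, s1 <= s <= s2 -> t1 <= t <= t2 ->
       Cmod (h (radial s t) - (c0 + l * (radial s t - a))) <= eta * (2 * r * d)).
    { intros s t Hs Ht.
      assert (Hz : Cmod (radial s t - z0) <= 2 * r * d).
      { eapply Rle_trans; [apply radial_lipschitz; lra|].
        apply Rmult_le_compat_l; [lra|]. unfold d.
        apply Rplus_le_compat; apply Rabs_le; lra. }
      assert (Hz' : Cmod (radial s t - z0) < d1) by (unfold d in Hz; nra).
      replace (h (radial s t) - (c0 + l * (radial s t - a)))%C with
        (h (radial s t) - h z0 - l * (radial s t - z0))%C by (unfold c0; ring).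
      eapply Rle_trans; [apply Hloc, Hz'|]. apply Rmult_le_compat_l; lra. }
    assert (Hd : 0 <= d) by (unfold d; lra).
    assert (HA : forall s, s1 <= s <= s2 ->
       Cmod (angular s t1 t2 - (Pi s t2 - Pi s t1)) <= (t2 - t1) * (eta * (2 * r * d) * kap)).
    { intros s Hs. 
      apply (CInt_near_exact (fun t => (h (radial s t) * cauchy_kernel t)%C) (Pi s)
        (fun t => ((c0 + l * (radial s t - a)) * cauchy_kernel t)%C)); try lra.
      - intros t _. apply ccont_mult; [apply ccont_h_t; lra|apply ccont_cauchy_kernel].
      - intros t _. unfold Pi.
        replace ((c0 + l * (radial s t - a)) * cauchy_kernel t)%C with
          (c0 * (0 + cauchy_kernel t) + l * ((radial s t - a) * cauchy_kernel t))%C by ring.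
        apply cderiv_plus; apply cderiv_Cmult; [|apply cderiv_radial_t].
        apply (cderiv_plus (fun _ => RtoC s)); [apply cderiv_const|].
        apply cderiv_kernel_primitive.
      - intros t _. apply ccont_mult; [|apply ccont_cauchy_kernel].
        apply ccont_plus; [apply ccont_const|]. apply ccont_mult; [apply ccont_const|].
        apply ccont_minus; [apply ccont_radial_t|apply ccont_const].
      - intros t Ht.
        replace (h (radial s t) * cauchy_kernel t - (c0 + l * (radial s t - a)) * cauchy_kernel t)%C with
          ((h (radial s t) - (c0 + l * (radial s t - a))) * cauchy_kernel t)%C by ring.
        rewrite Cmod_mult. apply Rmult_le_compat; try apply Cmod_ge_0.
        + now apply Herr.
        + apply Cmod_cauchy_kernel. }
    assert (HU : forall t, t1 <= t <= t2 ->
       Cmod (axial t s1 s2 - (Pi s2 t - Pi s1 t)) <= (s2 - s1) * (eta * (2 * r * d))).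
    { intros t Ht.
      apply (CInt_near_exact (fun s => h (radial s t)) (fun s => Pi s t)
        (fun s => (c0 + l * (radial s t - a))%C)); try lra.
      - intros s Hs. apply ccont_h_s; lra.
      - intros s _. unfold Pi.
        replace (c0 + l * (radial s t - a))%C with
          (c0 * (1 + 0) + l * (radial s t - a))%C by ring.
        apply cderiv_plus; apply cderiv_Cmult; [|apply cderiv_radial_s].
        apply (cderiv_plus RtoC (fun _ => kernel_primitive t)); [|apply cderiv_const].
        apply (cderiv_pair (fun s => s) (fun _ => 0)); auto_derive; trivial.
      - intros s _. 
        apply ccont_plus; [apply ccont_const|]. apply ccont_mult; [apply ccont_const|].
        apply (ccont_minus (fun s => radial s t)); [apply ccont_radial_s|apply ccont_const].
      - intros s Hs. now apply Herr. }
    unfold J.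
    replace (angular s2 t1 t2 - angular s1 t1 t2 - (axial t2 s1 s2 - axial t1 s1 s2))%C with
      (((angular s2 t1 t2 - (Pi s2 t2 - Pi s2 t1)) - (angular s1 t1 t2 - (Pi s1 t2 - Pi s1 t1))) -
       ((axial t2 s1 s2 - (Pi s2 t2 - Pi s1 t2)) - (axial t1 s1 s2 - (Pi s2 t1 - Pi s1 t1))))%C by ring.
    assert (tri : forall x y : C, Cmod (x - y) <= Cmod x + Cmod y).
    { intros x y. eapply Rle_trans; [apply Cmod_triangle|]. rewrite Cmod_opp; lra. }
    eapply Rle_trans; [apply tri|].
    eapply Rle_trans; [apply Rplus_le_compat; apply tri|].
    generalize (HA s1 ltac:(lra)) (HA s2 ltac:(lra)) (HU t1 ltac:(lra)) (HU t2 ltac:(lra)).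
    fold d. intros E1 E2 E3 E4.
    replace (eps * d ^ 2) with (4 * eta * r * (kap + 1) * d ^ 2) by (unfold eta; field; split; lra).
    set (X := eta * (2 * r * d)) in *.
    assert (HX : 0 <= X) by (apply Rmult_le_pos; [lra|]; apply Rmult_le_pos; lra).
    replace (4 * eta * r * (kap + 1) * d ^ 2) with (2 * d * (X * kap) + 2 * d * X) by (unfold X; ring).
    assert (0 <= X * kap) by (apply Rmult_le_pos; lra).
    assert ((t2 - t1) * (X * kap) <= d * (X * kap)) by (apply Rmult_le_compat_r; unfold d; lra).
    assert ((s2 - s1) * X <= d * X) by (apply Rmult_le_compat_r; unfold d; lra).
    lra. }
assert (Hper : axial (2 * PI) s0 0 = axial 0 s0 0).
{ unfold axial, radial. now rewrite circle_2PI. }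
unfold J in HJ. rewrite Hper in HJ.
replace (angular s0 0 (2 * PI)) with
  (angular 0 0 (2 * PI) - (angular 0 0 (2 * PI) - angular s0 0 (2 * PI) - (axial 0 s0 0 - axial 0 s0 0)))%C by ring.
rewrite HJ. ring.
Qed.
End Radial.

(** * Cauchy formula and Taylor expansion in one variable *)

Fixpoint csum (u : nat -> C) (n : nat) : C :=
  match n with O => RtoC 0 | S m => (csum u m + u m)%C end.

Definition square_sum (u : nat -> nat -> C) (n : nat) : C := csum (fun i => csum (u i) n) n.

Lemma csum_ext u v n : (forall k, (k < n)%nat -> u k = v k) -> csum u n = csum v n.
Proof. induction n as [|n IH]; intros H; simpl; [reflexivity|]. rewrite IH, H by auto with arith. reflexivity. Qed.

Lemma csum_minus u v n : csum (fun k => (u k - v k)%C) n = (csum u n - csum v n)%C.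
Proof. induction n as [|n IH]; simpl; [ring|rewrite IH; ring]. Qed.

Lemma csum_plus u v n : csum (fun k => (u k + v k)%C) n = (csum u n + csum v n)%C.
Proof. induction n as [|n IH]; simpl; [ring|rewrite IH; ring]. Qed.

Lemma csum_mult (c : C) u n : csum (fun k => (c * u k)%C) n = (c * csum u n)%C.
Proof. induction n as [|n IH]; simpl; [ring|rewrite IH; ring]. Qed.

Lemma Cmod_csum_geom u K n : 0 <= K -> (forall k, (k < n)%nat -> Cmod (u k) <= K * (/ 2) ^ k) ->
  Cmod (csum u n) <= 2 * K.
Proof.
intros HK H. enough (Cmod (csum u n) <= 2 * K * (1 - (/ 2) ^ n)).
{ assert (0 <= (/ 2) ^ n) by (apply pow_le; lra). nra. }
induction n as [|n IH]; simpl.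
- rewrite Cmod_0. lra.
- eapply Rle_trans; [apply Cmod_triangle|].
  generalize (IH (fun k Hk => H k (Nat.lt_lt_succ_r _ _ Hk))) (H n (Nat.lt_succ_diag_r n)). lra.
Qed.

Lemma Cmod_minus_le (x y : C) : Cmod (x - y) <= Cmod x + Cmod y.
Proof. eapply Rle_trans; [apply Cmod_triangle|]. rewrite Cmod_opp; lra. Qed.

Lemma half_pow_small K e : 0 < e -> exists N, forall n, (N <= n)%nat -> K * (/ 2) ^ n < e.
Proof.
intros He. destruct (pow_lt_1_zero (/ 2)) with (y := e / (Rabs K + 1)) as [N HN].
{ rewrite Rabs_pos_eq; lra. }
{ apply Rdiv_lt_0_compat; [lra|]. generalize (Rabs_pos K); lra. }
exists N. intros n Hn. specialize (HN n Hn).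
assert (0 < (/ 2) ^ n) by (apply pow_lt; lra).
rewrite Rabs_pos_eq in HN by lra.
assert (HK := Rabs_pos K). assert (K <= Rabs K) by apply Rle_abs.
replace e with ((Rabs K + 1) * (e / (Rabs K + 1))) by (field; lra). nra.
Qed.

(** Lets an error of order [2^-n] tend to zero in an inequality. *)
Lemma le_of_half_pow x y K : (forall n, x <= y + K * (/ 2) ^ n) -> x <= y.
Proof.
intros H. apply le_epsilon. intros e He.
destruct (half_pow_small K e He) as [N HN].
generalize (H N) (HN N (le_n _)); lra.
Qed.

(** The crude constant [(2 rho)^k / rho] replaces [k rho^(k-1)] so that the bound
    stays geometric. *)
Lemma pow_difference (a b : C) rho k : Cmod a <= rho -> Cmod b <= rho ->
  rho * Cmod (a ^ k - b ^ k) <= (2 * rho) ^ k * Cmod (a - b).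
Proof.
intros Ha Hb. assert (Hr : 0 <= rho) by (eapply Rle_trans; [apply Cmod_ge_0|exact Ha]).
assert (Hd := Cmod_ge_0 (a - b)).
induction k as [|k IH]; simpl.
- replace (1 - 1)%C with (RtoC 0) by ring. rewrite Cmod_0. lra.
- replace (a * a ^ k - b * b ^ k)%C with (a * (a ^ k - b ^ k) + (a - b) * b ^ k)%C by ring.
  assert (Hp : rho ^ k <= (2 * rho) ^ k) by (apply pow_incr; lra).
  assert (Hb' : Cmod (b ^ k) <= rho ^ k)
    by (rewrite Cmod_pow; apply pow_incr; split; [apply Cmod_ge_0|assumption]).
  eapply Rle_trans; [apply Rmult_le_compat_l; [exact Hr|apply Cmod_triangle]|].
  rewrite !Cmod_mult.
  assert (E1 : Cmod a * (rho * Cmod (a ^ k - b ^ k)) <= rho * ((2 * rho) ^ k * Cmod (a - b))).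
  { apply Rmult_le_compat; try assumption; [apply Cmod_ge_0|]. apply Rmult_le_pos; [assumption|apply Cmod_ge_0]. }
  assert (E2 : rho * (Cmod (a - b) * Cmod (b ^ k)) <= rho * (Cmod (a - b) * (2 * rho) ^ k)).
  { apply Rmult_le_compat_l; [assumption|]. apply Rmult_le_compat_l; lra. }
  lra.
Qed.

Lemma circle_neq_0 r t : 0 < r -> circle r t <> RtoC 0.
Proof. intros Hr. apply Cmod_gt_0. rewrite Cmod_circle; lra. Qed.

(** De Moivre's formula, needed only to exhibit a primitive of the powers. *)
Lemma inv_circle_pow r t n : 0 < r ->
  ((/ circle r t) ^ n)%C = ((/ r) ^ n * cos (INR n * t), - ((/ r) ^ n * sin (INR n * t))).
Proof.
intros Hr. induction n as [|n IH].
- simpl. rewrite Rmult_0_l, cos_0, sin_0. unfold RtoC. f_equal; ring.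
- rewrite S_INR. replace ((INR n + 1) * t) with (INR n * t + t) by ring.
  rewrite cos_plus, sin_plus. cbn [Cpow pow]. rewrite IH.
  set (q := (/ r * cos t, - (/ r * sin t)) : C).
  replace (/ circle r t)%C with q.
  + apply injective_projections; simpl; ring.
  + assert (H : (circle r t * q = 1)%C).
    { apply injective_projections; simpl; [|ring].
      transitivity (r * / r * (Rsqr (sin t) + Rsqr (cos t))); [unfold Rsqr; ring|].
      rewrite sin2_cos2. field; lra. }
    rewrite <- (Cmult_1_l q), <- (Cinv_l (circle r t)), <- Cmult_assoc, H.
    * ring.
    * now apply circle_neq_0.
Qed.

Lemma circle_moments r n : 0 < r ->
  is_CInt (fun t => ((/ circle r t) ^ n)%C) 0 (2 * PI) (if n then RtoC (2 * PI) else RtoC 0).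
Proof.
intros Hr. destruct n as [|n].
- replace (RtoC (2 * PI)) with (@scal R_AbsRing C_R_NormedModule (2 * PI - 0) (RtoC 1)).
  + apply (@is_RInt_const C_R_NormedModule).
  + apply injective_projections; simpl; unfold scal; simpl; unfold mult; simpl; ring.
- set (k := S n). assert (Hk : INR k <> 0) by (apply not_0_INR; discriminate). clearbody k.
  apply (@is_RInt_ext C_R_NormedModule (fun t => ((/ r) ^ k * cos (INR k * t), - ((/ r) ^ k * sin (INR k * t))))).
  { intros t _. symmetry. now apply inv_circle_pow. }
  set (P := fun t => ((/ r) ^ k * (sin (INR k * t) / INR k), (/ r) ^ k * (cos (INR k * t) / INR k))).
  replace (RtoC 0) with (@minus C_R_NormedModule (P (2 * PI)) (P 0)).
  2:{ unfold P. replace (INR k * (2 * PI)) with (0 + 2 * INR k * PI) by ring.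
      rewrite sin_period, cos_period, Rmult_0_r.
      apply (@minus_eq_zero C_R_NormedModule). }
  assert (HD : forall t, cderiv P t ((/ r) ^ k * cos (INR k * t), - ((/ r) ^ k * sin (INR k * t)))).
  { intros t. apply cderiv_pair; auto_derive; trivial; field; assumption. }
  apply (@is_RInt_derive C_R_CompleteNormedModule).
  + intros t _. apply HD.
  + intros t _. eapply cderiv_cont.
    apply cderiv_pair; auto_derive; trivial.
Qed.

(** The Cauchy integral for the [n]-th Taylor coefficient of [h] at 0. *)
Definition cauchy_coef (r : R) (h : C -> C) (n : nat) : C :=
  (/ RtoC (2 * PI) * CInt (fun t => (h (circle r t) * (/ circle r t) ^ n)%C) 0 (2 * PI))%C.

Lemma ccont_pow (f : R -> C) t n : ccont f t -> ccont (fun s => (f s ^ n)%C) t.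
Proof.
intros H. induction n as [|n IH]; simpl.
- apply ccont_const.
- now apply ccont_mult.
Qed.

Lemma ccont_inv_circle_pow r t n : 0 < r -> ccont (fun t => ((/ circle r t) ^ n)%C) t.
Proof.
intros Hr. apply (ccont_pow (fun t => (/ circle r t)%C)).
apply ccont_inv; [apply ccont_circle|now apply circle_neq_0].
Qed.

Lemma RtoC_2PI_neq : RtoC (2 * PI) <> RtoC 0.
Proof. intros E. apply RtoC_inj in E. generalize PI_RGT_0; lra. Qed.

Lemma cauchy_coef_is r h n : 0 < r -> (forall t, ccont (fun t => h (circle r t)) t) ->
  is_CInt (fun t => (h (circle r t) * (/ circle r t) ^ n)%C) 0 (2 * PI) (RtoC (2 * PI) * cauchy_coef r h n)%C.
Proof.
intros Hr Hh. unfold cauchy_coef. rewrite Cmult_assoc, Cinv_r, Cmult_1_l by apply RtoC_2PI_neq.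
apply ccont_CInt. intros t _. apply ccont_mult; [apply Hh|now apply ccont_inv_circle_pow].
Qed.

Lemma cauchy_coef_unique r h n c : 
  is_CInt (fun t => (h (circle r t) * (/ circle r t) ^ n)%C) 0 (2 * PI) (RtoC (2 * PI) * c)%C -> cauchy_coef r h n = c.
Proof.
intros H. unfold cauchy_coef. rewrite (is_CInt_unique _ _ _ _ H), Cmult_assoc, Cinv_l, Cmult_1_l by apply RtoC_2PI_neq.
reflexivity.
Qed.

Lemma cauchy_coef_minus r h1 h2 n : 0 < r -> (forall t, ccont (fun t => h1 (circle r t)) t) ->
  (forall t, ccont (fun t => h2 (circle r t)) t) ->
  cauchy_coef r (fun z => (h1 z - h2 z)%C) n = (cauchy_coef r h1 n - cauchy_coef r h2 n)%C.
Proof.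
intros Hr H1 H2. apply cauchy_coef_unique.
replace (RtoC (2 * PI) * (cauchy_coef r h1 n - cauchy_coef r h2 n))%C with
  (RtoC (2 * PI) * cauchy_coef r h1 n - RtoC (2 * PI) * cauchy_coef r h2 n)%C by ring.
eapply is_CInt_ext; [|apply is_CInt_minus; apply cauchy_coef_is; eassumption].
intros t; simpl; ring.
Qed.

Lemma cauchy_coef_bound r h n M : 0 < r -> (forall t, ccont (fun t => h (circle r t)) t) ->
  (forall t, Cmod (h (circle r t)) <= M) -> Cmod (cauchy_coef r h n) <= M * (/ r) ^ n.
Proof.
intros Hr Hc HM. assert (HPI := PI_RGT_0).
assert (H : Cmod (RtoC (2 * PI) * cauchy_coef r h n) <= (2 * PI - 0) * (M * (/ r) ^ n)).
{ eapply CInt_le; [lra| |exact (cauchy_coef_is r h n Hr Hc)].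
  intros t _; cbv beta; rewrite Cmod_mult, Cmod_pow, Cmod_inv by now apply circle_neq_0.
  rewrite Cmod_circle by lra.
  apply Rmult_le_compat_r; [apply pow_le; left; now apply Rinv_0_lt_compat|apply HM]. }
rewrite Cmod_mult, Cmod_R, Rabs_pos_eq, Rminus_0_r in H by lra. nra.
Qed.

Lemma cauchy_coef_linear r h1 h2 (c : C) n : 0 < r -> (forall t, ccont (fun t => h1 (circle r t)) t) ->
  (forall t, ccont (fun t => h2 (circle r t)) t) ->
  cauchy_coef r (fun z => (h1 z + h2 z * c)%C) n = (cauchy_coef r h1 n + cauchy_coef r h2 n * c)%C.
Proof.
intros Hr H1 H2. apply cauchy_coef_unique.
replace (RtoC (2 * PI) * (cauchy_coef r h1 n + cauchy_coef r h2 n * c))%C with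
  (RtoC (2 * PI) * cauchy_coef r h1 n + c * (RtoC (2 * PI) * cauchy_coef r h2 n))%C by ring.
eapply is_CInt_ext; [|apply is_CInt_plus; [|apply is_CInt_Cmult]; apply cauchy_coef_is; eassumption].
intros t; simpl; ring.
Qed.

Lemma cauchy_coef_csum r (b : nat -> C -> C) (c : nat -> C) n i : 0 < r ->
  (forall j t, ccont (fun t => b j (circle r t)) t) ->
  (forall t, ccont (fun t => csum (fun j => (b j (circle r t) * c j)%C) n) t) /\
  cauchy_coef r (fun z => csum (fun j => (b j z * c j)%C) n) i = csum (fun j => (cauchy_coef r (b j) i * c j)%C) n.
Proof.
intros Hr Hb. induction n as [|n [IH1 IH2]]; simpl.
- split; [intros; apply ccont_const|].
  apply cauchy_coef_unique. replace (RtoC (2 * PI) * 0)%C with (0 * (RtoC (2 * PI) * cauchy_coef r (b 0%nat) i))%C by ring.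
  eapply is_CInt_ext; [|apply is_CInt_Cmult, cauchy_coef_is; auto]. intros t; simpl; ring.
- split.
  + intros t. apply ccont_plus; [apply IH1|]. apply ccont_mult; [apply Hb|apply ccont_const].
  + rewrite <- IH2. apply (cauchy_coef_linear r (fun z => csum (fun j => (b j z * c j)%C) n) (b n)); auto.
Qed.

Section Cauchy.
Variables (h : C -> C) (r M : R).
Hypothesis Hr : 0 < r.
Hypothesis Hh : forall z, Cmod z <= r -> exists l, cdiff h z l.
Hypothesis HM : forall z, Cmod z <= r -> Cmod (h z) <= M.

Lemma sup_nonneg : 0 <= M.
Proof. eapply Rle_trans; [apply Cmod_ge_0|apply (HM (RtoC 0))]. rewrite Cmod_0. lra. Qed.

Lemma ccont_on_circle t : ccont (fun t => h (circle r t)) t.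
Proof.
destruct (Hh (circle r t)) as [l Hl]; [rewrite Cmod_circle; lra|].
eapply ccont_comp; [exact Hl|apply ccont_circle].
Qed.

(** Cauchy's formula in homogeneous form: the integral of
    [(h z - h a) dz / (z - a)] over the circle may be taken over circles
    shrinking to [a], where [h z - h a] tends to zero. *)
Lemma cauchy_vanishing a : Cmod a < r ->
  is_CInt (fun t => ((h (circle r t) - h a) * (circle r t / (circle r t - a)))%C) 0 (2 * PI) (RtoC 0).
Proof.
intros Ha. assert (HPI := PI_RGT_0).
assert (Hker : is_CInt (cauchy_kernel a r) 0 (2 * PI) (kernel_primitive a r (2 * PI)))
  by (apply ccont_CInt; intros t _; now apply ccont_cauchy_kernel).
assert (E : (angular a r h 0 0 (2 * PI) - h a * kernel_primitive a r (2 * PI))%C = RtoC 0).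
{ apply Cmod_eq_0, Rle_antisym; [|apply Cmod_ge_0].
  apply le_epsilon. intros e He. rewrite Rplus_0_l.
  set (kap := r / (r - Cmod a)).
  assert (Hkap : 0 < kap) by (apply Rdiv_lt_0_compat; lra).
  set (eta := e / (2 * PI * kap)).
  assert (Heta : 0 < eta) by (apply Rdiv_lt_0_compat; [lra|nra]).
  destruct (Hh a ltac:(lra)) as [l Hl].
  destruct (cdiff_continuous _ _ _ Hl eta Heta) as (d & Hd & Hcont).
  (* At [s = ln m] the contracted circle lies within [d / 2] of [a]. *)
  set (m := Rmin 1 (d / (4 * r))).
  assert (Hm : 0 < m) by (apply Rmin_pos; [lra|apply Rdiv_lt_0_compat; lra]).
  assert (Hs : ln m <= 0).
  { rewrite <- ln_1. apply Rcomplements.ln_le; [assumption|apply Rmin_l]. }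
  rewrite <- (angular_radius_invariant a r Ha h Hh (ln m) Hs).
  eassert (B : _ -> Cmod _ <= (2 * PI - 0) * (eta * kap)).
  { intros B. refine (CInt_le _ _ _ _ _ _ B (is_CInt_minus _ _ _ _ _ _
      (angular_is a r Ha h Hh (ln m) 0 (2 * PI) Hs) (is_CInt_Cmult (h a) _ _ _ _ Hker))). lra. }
  rewrite Rminus_0_r in B.
  replace e with (2 * PI * (eta * kap)) by (unfold eta; field; lra).
  apply B.
  intros t Ht.
  replace (h (radial a r (ln m) t) * cauchy_kernel a r t - h a * cauchy_kernel a r t)%C with
    ((h (radial a r (ln m) t) - h a) * cauchy_kernel a r t)%C by ring.
  rewrite Cmod_mult. apply Rmult_le_compat; try apply Cmod_ge_0.
  - left. apply Hcont. unfold radial.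
    replace (a + RtoC (exp (ln m)) * (circle r t - a) - a)%C with (RtoC (exp (ln m)) * (circle r t - a))%C by ring.
    rewrite exp_ln by assumption. rewrite Cmod_mult, Cmod_R, Rabs_pos_eq by lra.
    assert (N := circle_near a r Ha t).
    assert (m <= d / (4 * r)) by apply Rmin_r.
    assert (d / (4 * r) * (4 * r) = d) by (field; lra).
    assert (m * Cmod (circle r t - a) <= m * (2 * r)) by (apply Rmult_le_compat_l; lra).
    nra.
  - now apply Cmod_cauchy_kernel. }
assert (I := is_CInt_Cmult (- Ci)%C _ _ _ _
   (is_CInt_minus _ _ _ _ _ _ (angular_is a r Ha h Hh 0 0 (2 * PI) (Rle_refl 0)) (is_CInt_Cmult (h a) _ _ _ _ Hker))).
rewrite E in I. replace (- Ci * 0)%C with (RtoC 0) in I by ring.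
eapply is_CInt_ext; [|exact I]. intros t. simpl.
unfold cauchy_kernel. replace (radial a r 0 t) with (circle r t) by (unfold radial; rewrite exp_0; ring).
assert (Ci * Ci = - (1))%C by (apply injective_projections; simpl; ring).
replace (- Ci * (h (circle r t) * (Ci * circle r t / (circle r t - a)) - h a * (Ci * circle r t / (circle r t - a))))%C
  with (- (Ci * Ci) * ((h (circle r t) - h a) * (circle r t / (circle r t - a))))%C by (field; now apply circle_minus_neq).
rewrite H. ring.
Qed.

Definition taylor (a : C) n := csum (fun k => (cauchy_coef r h k * a ^ k)%C) n.

(** Induction on [n] from [w / (w - a) = 1 + (a / w) (w / (w - a))]; the term
    split off contributes [a^n] times the coefficient, and the constant [h a]
    contributes only for [n = 0], since the other moments of the circle vanish. *)
Lemma taylor_remainder_integral a n : Cmod a < r ->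
  is_CInt (fun t => ((h (circle r t) - h a) * ((a ^ S n * (/ circle r t) ^ S n) * (circle r t / (circle r t - a))))%C)
   0 (2 * PI) (RtoC (2 * PI) * (h a - taylor a (S n)))%C.
Proof.
intros Ha.
(* The conditional term records that only the zeroth moment is nonzero. *)
assert (step : forall n l,
  is_CInt (fun t => ((h (circle r t) - h a) * ((a ^ n * (/ circle r t) ^ n) * (circle r t / (circle r t - a))))%C) 0 (2 * PI) l ->
  is_CInt (fun t => ((h (circle r t) - h a) * ((a ^ S n * (/ circle r t) ^ S n) * (circle r t / (circle r t - a))))%C) 0 (2 * PI)
   (l - a ^ n * (RtoC (2 * PI) * cauchy_coef r h n - h a * (if n then RtoC (2 * PI) else 0)))%C).
{ clear n. intros n l Hl.
  eapply is_CInt_ext; [|apply is_CInt_minus; [exact Hl|apply is_CInt_Cmult; apply is_CInt_minus;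
    [apply cauchy_coef_is; [exact Hr|apply ccont_on_circle]|apply is_CInt_Cmult, circle_moments, Hr]]].
  intros t. simpl. field. split; [now apply circle_minus_neq|now apply circle_neq_0]. }
induction n as [|n IH].
- assert (H0 := step 0%nat (RtoC 0)). cbv beta iota in H0.
  assert (H1 : is_CInt
     (fun t => ((h (circle r t) - h a) * (a ^ 0 * (/ circle r t) ^ 0 * (circle r t / (circle r t - a))))%C)
     0 (2 * PI) (RtoC 0)).
  { eapply is_CInt_ext; [|apply (cauchy_vanishing a Ha)].
    intros t. simpl. f_equal. ring. }
  specialize (H0 H1).
  replace (RtoC (2 * PI) * (h a - taylor a 1))%C with
    (0 - a ^ 0 * (RtoC (2 * PI) * cauchy_coef r h 0 - h a * RtoC (2 * PI)))%C by (unfold taylor; simpl; ring).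
  exact H0.
- specialize (step (S n) _ IH). cbv iota in step.
  replace (RtoC (2 * PI) * (h a - taylor a (S (S n))))%C with
    (RtoC (2 * PI) * (h a - taylor a (S n)) - a ^ S n * (RtoC (2 * PI) * cauchy_coef r h (S n) - h a * 0))%C.
  + exact step.
  + unfold taylor. change (csum (fun k => (cauchy_coef r h k * a ^ k)%C) (S (S n))) with
      (csum (fun k => (cauchy_coef r h k * a ^ k)%C) (S n) + cauchy_coef r h (S n) * a ^ S n)%C. ring.
Qed.

(** On [|a| <= r / 2] the remainder integrand is at most
    [2 M * 2^-n * 2]. *)
Lemma taylor_error a n : Cmod a <= r / 2 -> Cmod (h a - taylor a n) <= 4 * M * (/ 2) ^ n.
Proof.
intros Ha. assert (HPI := PI_RGT_0). assert (HMp := sup_nonneg).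
destruct n as [|n].
{ unfold taylor; simpl. replace (h a - 0)%C with (h a) by ring.
  generalize (HM a ltac:(lra)); lra. }
eassert (B : _ -> Cmod _ <= (2 * PI - 0) * (2 * M * ((/ 2) ^ S n * 2))).
{ intros B. refine (CInt_le _ _ _ _ _ _ B (taylor_remainder_integral a n _)); lra. }
rewrite Cmod_mult, Cmod_R, Rabs_pos_eq, Rminus_0_r in B by lra.
assert (B' : 2 * PI * Cmod (h a - taylor a (S n)) <= 2 * PI * (2 * M * ((/ 2) ^ S n * 2))).
{ apply B. clear B. intros t _. rewrite Cmod_mult.
  assert (far : r / 2 <= Cmod (circle r t - a)).
  { generalize (circle_far a r ltac:(lra) t); lra. }
  apply Rmult_le_compat; try apply Cmod_ge_0.
  - eapply Rle_trans; [apply Cmod_minus_le|].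
    generalize (HM a ltac:(lra)) (HM (circle r t) ltac:(rewrite Cmod_circle; lra)). lra.
  - rewrite Cmod_mult. apply Rmult_le_compat; try apply Cmod_ge_0.
    + rewrite Cmod_mult, !Cmod_pow, <- Rpow_mult_distr. apply pow_incr. split.
      * apply Rmult_le_pos; apply Cmod_ge_0.
      * rewrite Cmod_inv, Cmod_circle by (try apply circle_neq_0; lra).
        apply Rmult_le_reg_r with r; [lra|]. rewrite Rmult_assoc, Rinv_l; lra.
    + rewrite Cmod_div, Cmod_circle by (try (apply circle_minus_neq; lra); lra).
      apply Rmult_le_reg_r with (Cmod (circle r t - a)); [lra|].
      unfold Rdiv. rewrite Rmult_assoc, Rinv_l by lra. lra. }
apply Rmult_le_reg_l in B'; lra.
Qed.

(** The Lipschitz constant depends only on [M] and [r]; this uniformity is what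
    makes the Cauchy coefficients of a function of two variables continuous in
    the other variable. *)
Lemma cauchy_lipschitz a b : Cmod a <= r / 4 -> Cmod b <= r / 4 ->
  Cmod (h a - h b) <= 8 * M / r * Cmod (a - b).
Proof.
intros Ha Hb. assert (HMp := sup_nonneg). assert (Hab := Cmod_ge_0 (a - b)).
apply le_of_half_pow with (8 * M). intros n.
replace (h a - h b)%C with ((h a - taylor a n) - (h b - taylor b n) + (taylor a n - taylor b n))%C by ring.
eapply Rle_trans; [apply Cmod_triangle|].
assert (E1 := taylor_error a n ltac:(lra)). assert (E2 := taylor_error b n ltac:(lra)).
assert (E3 := Cmod_minus_le (h a - taylor a n) (h b - taylor b n)).
enough (Cmod (taylor a n - taylor b n) <= 2 * (4 * M / r * Cmod (a - b))).
{ replace (8 * M / r * Cmod (a - b)) with (2 * (4 * M / r * Cmod (a - b))) by (field; lra). lra. }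
unfold taylor. rewrite <- csum_minus. apply Cmod_csum_geom.
- apply Rmult_le_pos; [|assumption]. apply Rmult_le_pos; [lra|left; now apply Rinv_0_lt_compat].
- intros k _. replace (cauchy_coef r h k * a ^ k - cauchy_coef r h k * b ^ k)%C with (cauchy_coef r h k * (a ^ k - b ^ k))%C by ring.
  rewrite Cmod_mult.
  assert (C1 : Cmod (cauchy_coef r h k) <= M * (/ r) ^ k).
  { apply cauchy_coef_bound; [assumption|apply ccont_on_circle|]. intros t. apply HM. rewrite Cmod_circle; lra. }
  assert (C2 := pow_difference a b (r / 4) k Ha Hb).
  assert (Hik : 0 < (/ r) ^ k) by (apply pow_lt; now apply Rinv_0_lt_compat).
  apply Rle_trans with (M * (/ r) ^ k * (4 / r * ((2 * (r / 4)) ^ k * Cmod (a - b)))).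
  + apply Rmult_le_compat; try apply Cmod_ge_0; [assumption|].
    apply Rmult_le_reg_l with (r / 4); [lra|]. eapply Rle_trans; [exact C2|].
    right. field. lra.
  + right. replace (2 * (r / 4)) with (r * / 2) by field. rewrite Rpow_mult_distr.
    assert ((/ r) ^ k * r ^ k = 1) by (rewrite <- Rpow_mult_distr, Rinv_l, pow1 by lra; reflexivity).
    transitivity (((/ r) ^ k * r ^ k) * (4 * M / r * Cmod (a - b) * (/ 2) ^ k)); [field; lra|].
    rewrite H. ring.
Qed.
End Cauchy.

(** * Expansion of separately holomorphic functions of two variables *)

Section TwoVariables.
Variables (F : C -> C -> C) (r M : R).
Hypothesis Hr : 0 < r.
Hypothesis Hx : forall x y, Cmod x <= 4 * r -> Cmod y <= 4 * r -> exists l, cdiff (fun u => F u y) x l.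
Hypothesis Hy : forall x y, Cmod x <= 4 * r -> Cmod y <= 4 * r -> exists l, cdiff (F x) y l.
Hypothesis HM : forall x y, Cmod x <= 4 * r -> Cmod y <= 4 * r -> Cmod (F x y) <= M.

Definition cauchy_coef2 (i j : nat) : C := cauchy_coef r (fun x => cauchy_coef r (F x) j) i.

Lemma inner_ccont x t : Cmod x <= 4 * r -> ccont (fun t => F x (circle r t)) t.
Proof.
intros H. apply (ccont_on_circle (F x) r Hr). intros y Hy'. apply Hy; lra.
Qed.

Lemma bound_nonneg : 0 <= M.
Proof. eapply Rle_trans; [apply Cmod_ge_0|apply (HM (RtoC 0) (RtoC 0))]; rewrite Cmod_0; lra. Qed.

Lemma inner_bound x j : Cmod x <= 4 * r -> Cmod (cauchy_coef r (F x) j) <= M * (/ r) ^ j.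
Proof.
intros H. apply cauchy_coef_bound; [exact Hr|intros; now apply inner_ccont|].
intros t. apply HM; [exact H|]. rewrite Cmod_circle; lra.
Qed.

Lemma inner_lipschitz x x' j : Cmod x <= r -> Cmod x' <= r ->
  Cmod (cauchy_coef r (F x) j - cauchy_coef r (F x') j) <= 2 * M / r * Cmod (x - x') * (/ r) ^ j.
Proof.
intros H H'. rewrite <- cauchy_coef_minus; [|exact Hr|intros; apply inner_ccont; lra|intros; apply inner_ccont; lra].
apply cauchy_coef_bound; [exact Hr| |].
- intros t. apply ccont_minus; apply inner_ccont; lra.
- intros t. replace (2 * M / r) with (8 * M / (4 * r)) by (field; lra).
  assert (Hc : Cmod (circle r t) <= 4 * r) by (rewrite Cmod_circle; lra).
  apply (cauchy_lipschitz (fun u => F u (circle r t)) (4 * r) M); try lra; auto.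
Qed.

Lemma outer_ccont j t : ccont (fun t => cauchy_coef r (F (circle r t)) j) t.
Proof.
apply ccont_eps. intros e He.
set (K := 2 * M / r * (/ r) ^ j).
assert (HK : 0 <= K).
{ apply Rmult_le_pos; [|apply pow_le; left; now apply Rinv_0_lt_compat].
  apply Rmult_le_pos; [generalize bound_nonneg; lra|left; now apply Rinv_0_lt_compat]. }
destruct (proj1 (ccont_eps _ _) (ccont_circle r t) (e / (K + 1))) as (d & Hd & H).
{ apply Rdiv_lt_0_compat; lra. }
exists d. split; [exact Hd|]. intros u Hu. specialize (H u Hu).
eapply Rle_lt_trans; [apply inner_lipschitz; rewrite Cmod_circle; lra|].
replace (2 * M / r * Cmod (circle r u - circle r t) * (/ r) ^ j) with (K * Cmod (circle r u - circle r t))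
  by (unfold K; ring).
replace e with ((K + 1) * (e / (K + 1))) by (field; lra).
generalize (Cmod_ge_0 (circle r u - circle r t)). nra.
Qed.

Lemma cauchy_coef2_bound i j : Cmod (cauchy_coef2 i j) <= M * (/ r) ^ j * (/ r) ^ i.
Proof.
apply (cauchy_coef_bound r (fun x => cauchy_coef r (F x) j) i (M * (/ r) ^ j) Hr (outer_ccont j)).
intros t. apply inner_bound. rewrite Cmod_circle; lra.
Qed.

(** Expand in [x] first, then expand the resulting coefficients, which are
    functions of [y], by applying the outer coefficient functional to the Taylor
    expansion in [y] on the circle. *)
Lemma square_sum_approx x y n : Cmod x <= r / 2 -> Cmod y <= r / 2 ->
  Cmod (F x y - square_sum (fun i j => (cauchy_coef2 i j * x ^ i * y ^ j)%C) n) <= 12 * M * (/ 2) ^ n.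
Proof.
intros Hx' Hy'. assert (HMp := bound_nonneg).
assert (Hn : 0 < (/ 2) ^ n) by (apply pow_lt; lra).
assert (Hcx : forall t, ccont (fun t => F (circle r t) y) t).
{ intros t. apply (ccont_on_circle (fun u => F u y) r Hr). intros u Hu. apply Hx; lra. }
replace (F x y - square_sum (fun i j => (cauchy_coef2 i j * x ^ i * y ^ j)%C) n)%C with
  ((F x y - taylor (fun u => F u y) r x n) +
   csum (fun i => ((cauchy_coef r (fun u => F u y) i - csum (fun j => (cauchy_coef2 i j * y ^ j)%C) n) * x ^ i)%C) n)%C.
2:{ unfold square_sum, taylor.
    rewrite (csum_ext (fun i => csum (fun j => (cauchy_coef2 i j * x ^ i * y ^ j)%C) n)
      (fun i => (x ^ i * csum (fun j => (cauchy_coef2 i j * y ^ j)%C) n)%C)).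
    2:{ intros i _. rewrite <- csum_mult. apply csum_ext. intros j _. ring. }
    rewrite (csum_ext (fun i => ((cauchy_coef r (fun u => F u y) i - csum (fun j => (cauchy_coef2 i j * y ^ j)%C) n) * x ^ i)%C)
      (fun i => (cauchy_coef r (fun u => F u y) i * x ^ i - x ^ i * csum (fun j => (cauchy_coef2 i j * y ^ j)%C) n)%C)).
    2:{ intros i _. ring. }
    rewrite csum_minus. ring. }
eapply Rle_trans; [apply Cmod_triangle|].
assert (E1 : Cmod (F x y - taylor (fun u => F u y) r x n) <= 4 * M * (/ 2) ^ n).
{ apply (taylor_error (fun u => F u y) r M Hr); [| |exact Hx']; intros z Hz; [apply Hx|apply HM]; lra. }
enough (Cmod (csum (fun i => ((cauchy_coef r (fun u => F u y) i - csum (fun j => (cauchy_coef2 i j * y ^ j)%C) n) * x ^ i)%C) n)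
   <= 2 * (4 * M * (/ 2) ^ n)) by lra.
apply Cmod_csum_geom; [nra|]. intros i _.
destruct (cauchy_coef_csum r (fun j u => cauchy_coef r (F u) j) (fun j => (y ^ j)%C) n i Hr outer_ccont) as [Hc E].
change (cauchy_coef r (fun z => csum (fun j => (cauchy_coef r (F z) j * y ^ j)%C) n) i = csum (fun j => (cauchy_coef2 i j * y ^ j)%C) n) in E.
rewrite <- E.
rewrite <- cauchy_coef_minus; [|exact Hr|exact Hcx|exact Hc].
rewrite Cmod_mult.
replace (4 * M * (/ 2) ^ n * (/ 2) ^ i) with (4 * M * (/ 2) ^ n * (/ r) ^ i * (r / 2) ^ i).
2:{ rewrite Rmult_assoc, <- Rpow_mult_distr. do 2 f_equal. field. lra. }
apply Rmult_le_compat; try apply Cmod_ge_0.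
- apply cauchy_coef_bound; [exact Hr|intros t; apply ccont_minus; [apply Hcx|apply Hc]|].
  intros t. assert (Hct : Cmod (circle r t) <= 4 * r) by (rewrite Cmod_circle; lra).
  apply (taylor_error (F (circle r t)) r M Hr); [| |exact Hy']; intros z Hz; [apply Hy|apply HM]; lra.
- rewrite Cmod_pow. apply pow_incr. split; [apply Cmod_ge_0|exact Hx'].
Qed.
End TwoVariables.

(** * Double power series *)

Definition clim (v : nat -> C) (l : C) : Prop :=
  forall e, 0 < e -> exists N, forall n, (N <= n)%nat -> Cmod (v n - l) < e.

Lemma clim_const (c : C) : clim (fun _ => c) c.
Proof. intros e He. exists 0%nat. intros n _. replace (c - c)%C with (RtoC 0) by ring. now rewrite Cmod_0. Qed.

Lemma clim_plus u v a b : clim u a -> clim v b -> clim (fun n => (u n + v n)%C) (a + b)%C.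
Proof.
intros Hu Hv e He. destruct (Hu (e / 2)) as [N1 H1]; [lra|]. destruct (Hv (e / 2)) as [N2 H2]; [lra|].
exists (max N1 N2). intros n Hn.
replace (u n + v n - (a + b))%C with ((u n - a) + (v n - b))%C by ring.
eapply Rle_lt_trans; [apply Cmod_triangle|].
generalize (H1 n ltac:(lia)) (H2 n ltac:(lia)); lra.
Qed.

Lemma clim_mult (c : C) u a : clim u a -> clim (fun n => (c * u n)%C) (c * a)%C.
Proof.
intros Hu e He. assert (Hc := Cmod_ge_0 c).
destruct (Hu (e / (Cmod c + 1))) as [N H]; [apply Rdiv_lt_0_compat; lra|].
exists N. intros n Hn. specialize (H n Hn).
replace (c * u n - c * a)%C with (c * (u n - a))%C by ring. rewrite Cmod_mult.
replace e with ((Cmod c + 1) * (e / (Cmod c + 1))) by (field; lra).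
generalize (Cmod_ge_0 (u n - a)); nra.
Qed.

Lemma clim_minus u v a b : clim u a -> clim v b -> clim (fun n => (u n - v n)%C) (a - b)%C.
Proof.
intros Hu Hv. assert (H := clim_plus _ _ _ _ Hu (clim_mult (-1) _ _ Hv)).
replace (a - b)%C with (a + -1 * b)%C by ring.
intros e He. destruct (H e He) as [N HN]. exists N. intros n Hn.
replace (u n - v n)%C with (u n + -1 * v n)%C by ring. auto.
Qed.

Lemma clim_ext N u v a : (forall n, (N <= n)%nat -> u n = v n) -> clim u a -> clim v a.
Proof.
intros E H e He. destruct (H e He) as [N' HN]. exists (max N N'). intros n Hn.
rewrite <- E by lia. apply HN; lia.
Qed.

Lemma clim_le u a B : clim u a -> (forall n, Cmod (u n) <= B) -> Cmod a <= B.
Proof.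
intros H HB. apply le_epsilon. intros e He. destruct (H e He) as [N HN].
replace a with (u N - (u N - a))%C by ring.
eapply Rle_trans; [apply Cmod_minus_le|]. generalize (HB N) (HN N (le_n _)); lra.
Qed.

Lemma clim_unique u a b : clim u a -> clim u b -> a = b.
Proof.
intros Ha Hb. assert (H := clim_minus _ _ _ _ Ha Hb).
assert (H0 : Cmod (a - b) <= 0).
{ apply (clim_le _ _ _ H). intros n. replace (u n - u n)%C with (RtoC 0) by ring. rewrite Cmod_0; lra. }
assert (E : (a - b)%C = RtoC 0) by (apply Cmod_eq_0, Rle_antisym; [exact H0|apply Cmod_ge_0]).
replace a with (a - b + b)%C by ring. rewrite E. ring.
Qed.

Definition climit (v : nat -> C) : C := (real (Lim_seq (fun n => fst (v n))), real (Lim_seq (fun n => snd (v n)))).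

Lemma clim_geometric v K : (forall n, Cmod (v (S n) - v n) <= K * (/ 2) ^ n) -> clim v (climit v).
Proof.
intros H.
assert (HK : 0 <= K) by (generalize (H 0%nat) (Cmod_ge_0 (v 1%nat - v 0%nat)); simpl; lra).
assert (tele : forall n k, Cmod (v (n + k)%nat - v n) <= 2 * K * (/ 2) ^ n * (1 - (/ 2) ^ k)).
{ intros n k. induction k as [|k IH].
  - rewrite Nat.add_0_r. replace (v n - v n)%C with (RtoC 0) by ring. rewrite Cmod_0. simpl. lra.
  - rewrite Nat.add_succ_r. replace (v (S (n + k)) - v n)%C with ((v (S (n + k)) - v (n + k)%nat) + (v (n + k)%nat - v n))%C by ring.
    eapply Rle_trans; [apply Cmod_triangle|]. specialize (H (n + k)%nat). rewrite pow_add in H. simpl. lra. }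
assert (cau : forall e, 0 < e -> exists N, forall n m, (N <= n)%nat -> (N <= m)%nat -> Cmod (v n - v m) < e).
{ intros e He. destruct (half_pow_small (4 * K) e He) as [N HN]. exists N. intros n m Hn Hm.
  specialize (HN N (le_n _)).
  assert (B : forall p, (N <= p)%nat -> Cmod (v p - v N) <= 2 * K * (/ 2) ^ N).
  { intros p Hp. specialize (tele N (p - N)%nat). replace (N + (p - N))%nat with p in tele by lia.
    assert (0 <= (/ 2) ^ (p - N)) by (apply pow_le; lra). assert (0 <= K * (/ 2) ^ N) by (apply Rmult_le_pos; [lra|apply pow_le; lra]). nra. }
  replace (v n - v m)%C with ((v n - v N) - (v m - v N))%C by ring.
  eapply Rle_lt_trans; [apply Cmod_minus_le|]. generalize (B n Hn) (B m Hm); lra. }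
assert (comp : forall z : C, Rabs (fst z) <= Cmod z /\ Rabs (snd z) <= Cmod z).
{ intros z. generalize (Rmax_Cmod z) (Rmax_l (Rabs (fst z)) (Rabs (snd z))) (Rmax_r (Rabs (fst z)) (Rabs (snd z))). lra. }
assert (L1 : is_lim_seq (fun n => fst (v n)) (real (Lim_seq (fun n => fst (v n))))).
{ apply Lim_seq_correct', ex_lim_seq_cauchy_corr. intros e. destruct (cau e (cond_pos e)) as [N HN].
  exists N. intros n m Hn Hm. eapply Rle_lt_trans; [apply (comp (v n - v m)%C)|]. auto. }
assert (L2 : is_lim_seq (fun n => snd (v n)) (real (Lim_seq (fun n => snd (v n))))).
{ apply Lim_seq_correct', ex_lim_seq_cauchy_corr. intros e. destruct (cau e (cond_pos e)) as [N HN].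
  exists N. intros n m Hn Hm. eapply Rle_lt_trans; [apply (comp (v n - v m)%C)|]. auto. }
intros e He. apply is_lim_seq_spec in L1, L2.
destruct (L1 (mkposreal (e / 4) ltac:(lra))) as [N1 H1]. destruct (L2 (mkposreal (e / 4) ltac:(lra))) as [N2 H2].
simpl in H1, H2.
exists (max N1 N2). intros n Hn. specialize (H1 n ltac:(lia)). specialize (H2 n ltac:(lia)).
eapply Rle_lt_trans; [apply Cmod_2Rmax|].
assert (E := sqrt2_le_2).
assert (0 <= sqrt 2) by apply sqrt_pos.
assert (Rmax (Rabs (fst (v n - climit v)%C)) (Rabs (snd (v n - climit v)%C)) <= e / 4)
  by (apply Rmax_lub; simpl; left; assumption).
nra.
Qed.

Lemma square_sum_ext u v n : (forall i j, u i j = v i j) -> square_sum u n = square_sum v n.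
Proof. intros H. apply csum_ext; intros i _. apply csum_ext; intros j _. apply H. Qed.

Lemma square_sum_minus u v n : square_sum (fun i j => (u i j - v i j)%C) n = (square_sum u n - square_sum v n)%C.
Proof. unfold square_sum. rewrite <- csum_minus. apply csum_ext; intros i _. apply csum_minus. Qed.

Lemma square_sum_plus u v n : square_sum (fun i j => (u i j + v i j)%C) n = (square_sum u n + square_sum v n)%C.
Proof. unfold square_sum. rewrite <- csum_plus. apply csum_ext; intros i _. apply csum_plus. Qed.

Lemma square_sum_mult c u n : square_sum (fun i j => (c * u i j)%C) n = (c * square_sum u n)%C.
Proof. unfold square_sum. rewrite <- csum_mult. apply csum_ext; intros i _. apply csum_mult. Qed.

Lemma square_sum_bound u K n : 0 <= K -> (forall i j, Cmod (u i j) <= K * (/ 2) ^ i * (/ 2) ^ j) ->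
  Cmod (square_sum u n) <= 4 * K.
Proof.
intros HK H. replace (4 * K) with (2 * (2 * K)) by ring. apply Cmod_csum_geom; [lra|]. intros i _.
replace (2 * K * (/ 2) ^ i) with (2 * (K * (/ 2) ^ i)) by ring. apply Cmod_csum_geom.
- apply Rmult_le_pos; [exact HK|apply pow_le; lra].
- intros j _. apply H.
Qed.

(** Passing from [n] to [n + 1] adds one row and one column, each of size
    [O(2^-n)]. *)
Lemma square_sum_converges u K : 0 <= K -> (forall i j, Cmod (u i j) <= K * (/ 2) ^ i * (/ 2) ^ j) ->
  clim (square_sum u) (climit (square_sum u)).
Proof.
intros HK H. apply clim_geometric with (4 * K). intros n.
replace (square_sum u (S n) - square_sum u n)%C with (csum (fun i => u i n) n + csum (u n) (S n))%C.
2:{ unfold square_sum. simpl. rewrite csum_plus. ring. }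
assert (Hn : 0 <= K * (/ 2) ^ n) by (apply Rmult_le_pos; [exact HK|apply pow_le; lra]).
eapply Rle_trans; [apply Cmod_triangle|].
replace (4 * K * (/ 2) ^ n) with (2 * (K * (/ 2) ^ n) + 2 * (K * (/ 2) ^ n)) by ring.
apply Rplus_le_compat; apply Cmod_csum_geom; try exact Hn; intros k _; [|apply H].
generalize (H k n); lra.
Qed.

(** From order 2 on, a square partial sum sees the resonant index (1, 1). *)
Lemma square_sum_corner (c : C) n :
  square_sum (fun i j => match i, j with 1%nat, 1%nat => c | _, _ => RtoC 0 end) (S (S n)) = c.
Proof.
assert (Z : forall n, csum (fun _ => RtoC 0) n = RtoC 0).
{ induction n0 as [|m IH]; simpl; [reflexivity|]. rewrite IH. ring. }
assert (D : forall c n, csum (fun k => match k with 1%nat => c | _ => RtoC 0 end) (S (S n)) = c).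
{ intros d m. induction m as [|m IH]; [simpl; ring|].
  change (csum (fun k => match k with 1%nat => d | _ => RtoC 0 end) (S (S m)) + 0 = d)%C. rewrite IH. ring. }
unfold square_sum. transitivity (csum (fun k => match k with 1%nat => c | _ => RtoC 0 end) (S (S n))); [|apply D].
apply csum_ext. intros i _.
destruct i as [|[|i]]; try apply Z. apply D.
Qed.

(** The derivative of [z^k], in a recursive form that avoids the exponent
    [k - 1]. *)
Fixpoint dpow (z : C) (k : nat) : C :=
  match k with O => RtoC 0 | S m => (z * dpow z m + z ^ m)%C end.

(** Multiplication by the variable turns derivatives of monomials back into
    monomials, so only series in [x^i y^j] are ever needed. *)
Lemma dpow_euler z k : (z * dpow z k = INR k * z ^ k)%C.
Proof.
induction k as [|k IH]; [simpl; ring|].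
rewrite S_INR, RtoC_plus. cbn [dpow Cpow].
replace (z * (z * dpow z k + z ^ k))%C with (z * (z * dpow z k) + z * z ^ k)%C by ring.
rewrite IH. ring.
Qed.

Section Monomials.
Variable rho : R.
Hypothesis Hrho : 0 < rho.

Lemma Cmod_Cpow_le z k : Cmod z <= rho -> Cmod (z ^ k) <= rho ^ k.
Proof. intros Hz. rewrite Cmod_pow. apply pow_incr. split; [apply Cmod_ge_0|exact Hz]. Qed.

Lemma Cmod_dpow_le z k : Cmod z <= rho -> rho * Cmod (dpow z k) <= (2 * rho) ^ k.
Proof.
intros Hz. induction k as [|k IH]; simpl; [rewrite Cmod_0; lra|].
assert (Hp := Cmod_Cpow_le z k Hz).
assert (rho ^ k <= (2 * rho) ^ k) by (apply pow_incr; lra).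
eapply Rle_trans; [apply Rmult_le_compat_l; [lra|apply Cmod_triangle]|]. rewrite Cmod_mult.
assert (Cmod z * (rho * Cmod (dpow z k)) <= rho * (2 * rho) ^ k).
{ apply Rmult_le_compat; try assumption; [apply Cmod_ge_0|]. apply Rmult_le_pos; [lra|apply Cmod_ge_0]. }
assert (rho * Cmod (z ^ k) <= rho * (2 * rho) ^ k) by (apply Rmult_le_compat_l; lra).
lra.
Qed.

(** As in [pow_difference], the quadratic constants [k (k - 1)] are absorbed in
    a geometric factor [4^k]. *)
Lemma pow_second_order z w k : Cmod z <= rho -> Cmod w <= rho ->
  rho ^ 2 * Cmod (w ^ k - z ^ k - dpow z k * (w - z)) <= (4 * rho) ^ k * Cmod (w - z) ^ 2.
Proof.
intros Hz Hw. assert (Hd := Cmod_ge_0 (w - z)). induction k as [|k IH].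
- simpl. replace (1 - 1 - 0 * (w - z))%C with (RtoC 0) by ring. rewrite Cmod_0. nra.
- replace (w ^ S k - z ^ S k - dpow z (S k) * (w - z))%C with
    (z * (w ^ k - z ^ k - dpow z k * (w - z)) + (w - z) * (w ^ k - z ^ k))%C by (simpl; ring).
  eapply Rle_trans; [apply Rmult_le_compat_l; [nra|apply Cmod_triangle]|]. rewrite !Cmod_mult.
  assert (P := pow_difference w z rho k Hw Hz).
  assert ((2 * rho) ^ k <= (4 * rho) ^ k) by (apply pow_incr; lra).
  assert (0 <= (2 * rho) ^ k) by (apply pow_le; lra).
  set (q := Cmod (w ^ k - z ^ k - dpow z k * (w - z))) in *.
  set (e := Cmod (w ^ k - z ^ k)) in *. set (d := Cmod (w - z)) in *.
  assert (A1 : Cmod z * (rho ^ 2 * q) <= rho * ((4 * rho) ^ k * d ^ 2)).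
  { apply Rmult_le_compat; try assumption; [apply Cmod_ge_0|]. apply Rmult_le_pos; [nra|apply Cmod_ge_0]. }
  assert (A2 : rho * d * (rho * e) <= rho * d * ((2 * rho) ^ k * d)) by (apply Rmult_le_compat_l; [nra|exact P]).
  assert (A3 : rho * d * ((2 * rho) ^ k * d) <= rho * d * ((4 * rho) ^ k * d)).
  { apply Rmult_le_compat_l; [nra|]. apply Rmult_le_compat_r; lra. }
  assert (0 <= rho * ((4 * rho) ^ k * d ^ 2)) by (apply Rmult_le_pos; [lra|apply Rmult_le_pos; [lra|apply pow2_ge_0]]).
  simpl pow in *. nra.
Qed.

Lemma monomial_second_order i j (x y x' y' : C) :
  Cmod x <= rho -> Cmod y <= rho -> Cmod x' <= rho -> Cmod y' <= rho ->
  rho ^ 2 * Cmod (x' ^ i * y' ^ j - x ^ i * y ^ j - (dpow x i * y ^ j) * (x' - x) - (x ^ i * dpow y j) * (y' - y))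
   <= (4 * rho) ^ i * (4 * rho) ^ j * (Cmod (x' - x) + Cmod (y' - y)) ^ 2.
Proof.
intros Hx Hy Hx' Hy'.
replace (x' ^ i * y' ^ j - x ^ i * y ^ j - (dpow x i * y ^ j) * (x' - x) - (x ^ i * dpow y j) * (y' - y))%C with
  ((x' ^ i - x ^ i - dpow x i * (x' - x)) * y' ^ j + (dpow x i * (x' - x) * (y' ^ j - y ^ j)
   + x ^ i * (y' ^ j - y ^ j - dpow y j * (y' - y))))%C by ring.
assert (T1 := pow_second_order x x' i Hx Hx'). assert (T2 := pow_second_order y y' j Hy Hy').
assert (T3 := Cmod_dpow_le x i Hx). assert (T4 := pow_difference y' y rho j Hy' Hy).
assert (T5 := Cmod_Cpow_le y' j Hy'). assert (T6 := Cmod_Cpow_le x i Hx).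
eapply Rle_trans; [apply Rmult_le_compat_l; [nra|]|].
{ eapply Rle_trans; [apply Cmod_triangle|]. apply Rplus_le_compat_l, Cmod_triangle. }
rewrite !Cmod_mult.
set (u := Cmod (x' - x)) in *. set (v := Cmod (y' - y)) in *.
assert (Hu : 0 <= u) by apply Cmod_ge_0. assert (Hv : 0 <= v) by apply Cmod_ge_0.
set (Rx := Cmod (x' ^ i - x ^ i - dpow x i * (x' - x))) in *.
set (Ry := Cmod (y' ^ j - y ^ j - dpow y j * (y' - y))) in *.
set (Dx := Cmod (dpow x i)) in *. set (Dy := Cmod (y' ^ j - y ^ j)) in *.
assert (P1 : forall k, 0 <= rho ^ k <= (4 * rho) ^ k) by (intros k; split; [apply pow_le; lra|apply pow_incr; lra]).
assert (P2 : forall k, 0 <= (2 * rho) ^ k <= (4 * rho) ^ k) by (intros k; split; [apply pow_le; lra|apply pow_incr; lra]).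
assert (B1 : rho ^ 2 * Rx * Cmod (y' ^ j) <= (4 * rho) ^ i * u ^ 2 * (4 * rho) ^ j).
{ apply Rmult_le_compat; [apply Rmult_le_pos; [nra|apply Cmod_ge_0]|apply Cmod_ge_0|exact T1|].
  generalize (P1 j); lra. }
assert (B2 : rho * Dx * (rho * Dy) <= (4 * rho) ^ i * ((4 * rho) ^ j * v)).
{ apply Rmult_le_compat; [apply Rmult_le_pos; [lra|apply Cmod_ge_0]|apply Rmult_le_pos; [lra|apply Cmod_ge_0]| |].
  - generalize (P2 i); lra.
  - eapply Rle_trans; [exact T4|]. apply Rmult_le_compat_r; [exact Hv|apply P2]. }
assert (B3 : Cmod (x ^ i) * (rho ^ 2 * Ry) <= (4 * rho) ^ i * ((4 * rho) ^ j * v ^ 2)).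
{ apply Rmult_le_compat; [apply Cmod_ge_0|apply Rmult_le_pos; [nra|apply Cmod_ge_0]| |exact T2].
  generalize (P1 i); lra. }
assert (B2' := Rmult_le_compat_l u _ _ Hu B2).
assert (0 <= (4 * rho) ^ i * (4 * rho) ^ j * (u * v)).
{ apply Rmult_le_pos; [apply Rmult_le_pos; apply pow_le; lra|nra]. }
simpl pow in *. nra.
Qed.
End Monomials.

Section PowerSeries.
Variables (c : nat -> nat -> C) (M A rho : R).
Hypothesis HM : 0 <= M.
Hypothesis HA : 0 <= A.
Hypothesis Hrho : 0 < rho.
Hypothesis Hsmall : 8 * A * rho <= 1.
Hypothesis Hc : forall i j, Cmod (c i j) <= M * A ^ i * A ^ j.

Definition psum (p : C * C) : C :=
  climit (square_sum (fun i j => (c i j * (fst p ^ i * snd p ^ j))%C)).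

Definition psum_x (p : C * C) : C :=
  climit (square_sum (fun i j => (c i j * (dpow (fst p) i * snd p ^ j))%C)).

Definition psum_y (p : C * C) : C :=
  climit (square_sum (fun i j => (c i j * (fst p ^ i * dpow (snd p) j))%C)).

Definition in_polydisc (p : C * C) := Cmod (fst p) <= rho /\ Cmod (snd p) <= rho.

Lemma small_pow k : A ^ k * (4 * rho) ^ k <= (/ 2) ^ k.
Proof. rewrite <- Rpow_mult_distr. apply pow_incr. split; [nra|lra]. Qed.

(** On a polydisc of radius [rho <= 1 / (8 A)] every quantity attached to a
    monomial is at most [(4 rho)^(i+j)] up to a constant, and the coefficients
    turn this into a bound by [2^-(i+j)]. *)
Lemma term_bound (t : nat -> nat -> C) K : 0 <= K ->
  (forall i j, Cmod (t i j) <= (4 * rho) ^ i * (4 * rho) ^ j * K) ->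
  forall i j, Cmod (c i j * t i j) <= M * K * (/ 2) ^ i * (/ 2) ^ j.
Proof.
intros HK Ht i j. rewrite Cmod_mult.
eapply Rle_trans; [apply Rmult_le_compat; [apply Cmod_ge_0|apply Cmod_ge_0|apply Hc|apply Ht]|].
assert (P1 := small_pow i). assert (P2 := small_pow j).
assert (Q1 : 0 <= A ^ i * (4 * rho) ^ i) by (apply Rmult_le_pos; apply pow_le; lra).
assert (Q2 : 0 <= A ^ j * (4 * rho) ^ j) by (apply Rmult_le_pos; apply pow_le; lra).
replace (M * A ^ i * A ^ j * ((4 * rho) ^ i * (4 * rho) ^ j * K)) with
  (M * K * ((A ^ i * (4 * rho) ^ i) * (A ^ j * (4 * rho) ^ j))) by ring.
rewrite (Rmult_assoc (M * K)). apply Rmult_le_compat_l; [now apply Rmult_le_pos|].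
now apply Rmult_le_compat.
Qed.

Lemma pow_rho_le k : rho ^ k <= (4 * rho) ^ k.
Proof. apply pow_incr; lra. Qed.

Lemma dpow_bound z k : Cmod z <= rho -> Cmod (dpow z k) <= (4 * rho) ^ k * / rho.
Proof.
intros Hz. assert (H := Cmod_dpow_le rho Hrho z k Hz).
assert ((2 * rho) ^ k <= (4 * rho) ^ k) by (apply pow_incr; lra).
apply Rmult_le_reg_l with rho; [exact Hrho|].
replace (rho * ((4 * rho) ^ k * / rho)) with ((4 * rho) ^ k) by (field; lra). lra.
Qed.

Lemma pow_bound z k : Cmod z <= rho -> Cmod (z ^ k) <= (4 * rho) ^ k.
Proof. intros Hz. eapply Rle_trans; [apply (Cmod_Cpow_le rho); eassumption|apply pow_rho_le]. Qed.

Lemma psum_clim p : in_polydisc p ->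
  clim (square_sum (fun i j => (c i j * (fst p ^ i * snd p ^ j))%C)) (psum p).
Proof.
intros [H1 H2]. apply square_sum_converges with (M * 1); [lra|].
apply term_bound; [lra|]. intros i j. rewrite Cmod_mult, Rmult_1_r.
apply Rmult_le_compat; try apply Cmod_ge_0; now apply pow_bound.
Qed.

Lemma psum_x_clim p : in_polydisc p ->
  clim (square_sum (fun i j => (c i j * (dpow (fst p) i * snd p ^ j))%C)) (psum_x p).
Proof.
intros [H1 H2]. assert (0 <= / rho) by (left; now apply Rinv_0_lt_compat).
apply square_sum_converges with (M * / rho); [now apply Rmult_le_pos|].
apply term_bound; [assumption|]. intros i j. rewrite Cmod_mult.
replace ((4 * rho) ^ i * (4 * rho) ^ j * / rho) with ((4 * rho) ^ i * / rho * (4 * rho) ^ j) by ring.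
apply Rmult_le_compat; try apply Cmod_ge_0; [now apply dpow_bound|now apply pow_bound].
Qed.

Lemma psum_y_clim p : in_polydisc p ->
  clim (square_sum (fun i j => (c i j * (fst p ^ i * dpow (snd p) j))%C)) (psum_y p).
Proof.
intros [H1 H2]. assert (0 <= / rho) by (left; now apply Rinv_0_lt_compat).
apply square_sum_converges with (M * / rho); [now apply Rmult_le_pos|].
apply term_bound; [assumption|]. intros i j. rewrite Cmod_mult, Rmult_assoc.
apply Rmult_le_compat; try apply Cmod_ge_0; [now apply pow_bound|now apply dpow_bound].
Qed.

(** The estimate holds for every square partial sum with the same constant,
    hence for the limit; no term-by-term differentiation theorem is used. *)
Lemma psum_second_order p q : in_polydisc p -> in_polydisc q ->
  Cmod (psum q - psum p - psum_x p * (fst q - fst p) - psum_y p * (snd q - snd p))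
   <= 4 * M / rho ^ 2 * (Cmod (fst q - fst p) + Cmod (snd q - snd p)) ^ 2.
Proof.
intros Hp Hq.
set (D := Cmod (fst q - fst p) + Cmod (snd q - snd p)).
assert (L := clim_minus _ _ _ _ (clim_minus _ _ _ _ (clim_minus _ _ _ _ (psum_clim q Hq) (psum_clim p Hp))
   (clim_mult (fst q - fst p)%C _ _ (psum_x_clim p Hp))) (clim_mult (snd q - snd p)%C _ _ (psum_y_clim p Hp))).
replace (psum q - psum p - psum_x p * (fst q - fst p) - psum_y p * (snd q - snd p))%C with
  (psum q - psum p - (fst q - fst p) * psum_x p - (snd q - snd p) * psum_y p)%C by ring.
apply (clim_le _ _ _ L). intros n. cbv beta.
rewrite <- !square_sum_mult, <- !square_sum_minus.
assert (H2 : 0 < rho ^ 2) by (apply pow_lt; exact Hrho).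
assert (HK : 0 <= / rho ^ 2 * D ^ 2).
{ apply Rmult_le_pos; [left; now apply Rinv_0_lt_compat|apply pow2_ge_0]. }
replace (4 * M / rho ^ 2 * D ^ 2) with (4 * (M * (/ rho ^ 2 * D ^ 2))) by (field; lra).
apply square_sum_bound; [now apply Rmult_le_pos|].
intros i j.
replace (c i j * (fst q ^ i * snd q ^ j) - c i j * (fst p ^ i * snd p ^ j) -
   (fst q - fst p) * (c i j * (dpow (fst p) i * snd p ^ j)) -
   (snd q - snd p) * (c i j * (fst p ^ i * dpow (snd p) j)))%C with
  (c i j * (fst q ^ i * snd q ^ j - fst p ^ i * snd p ^ j - (dpow (fst p) i * snd p ^ j) * (fst q - fst p)
    - (fst p ^ i * dpow (snd p) j) * (snd q - snd p)))%C by ring.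
revert i j. apply (term_bound (fun i j => (fst q ^ i * snd q ^ j - fst p ^ i * snd p ^ j - (dpow (fst p) i * snd p ^ j) * (fst q - fst p)
    - (fst p ^ i * dpow (snd p) j) * (snd q - snd p))%C)); [exact HK|].
intros i j. destruct Hp as [p1 p2], Hq as [q1 q2].
apply Rmult_le_reg_l with (rho ^ 2); [exact H2|].
eapply Rle_trans; [apply (monomial_second_order rho Hrho); assumption|].
right. fold D. field. lra.
Qed.
End PowerSeries.

(** * Holomorphic germs *)

Lemma locally_C2 (p : C2) (P : C2 -> Prop) : locally p P <->
  exists d, 0 < d /\ forall q : C2, Cmod (fst q - fst p) < d -> Cmod (snd q - snd p) < d -> P q.
Proof.
split.
- intros [e He]. exists e. split; [apply cond_pos|]. intros q H1 H2. apply He.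
  split; apply C_NormedModule_mixin_compat1; assumption.
- intros (d & Hd & H). exists (mkposreal (d / 2) ltac:(lra)). intros q [H1 H2].
  assert (E := sqrt2_le_2).
  apply H.
  + eapply Rlt_le_trans; [apply (C_NormedModule_mixin_compat2 _ _ _ H1)|]. simpl. nra.
  + eapply Rlt_le_trans; [apply (C_NormedModule_mixin_compat2 _ _ _ H2)|]. simpl. nra.
Qed.

Lemma norm_C2 (p : C2) : norm p = sqrt (Cmod (fst p) ^ 2 + Cmod (snd p) ^ 2).
Proof. reflexivity. Qed.

Lemma norm_C2_lower (p : C2) : Cmod (fst p) + Cmod (snd p) <= 2 * norm p.
Proof.
rewrite norm_C2.
assert (H1 := Cmod_ge_0 (fst p)). assert (H2 := Cmod_ge_0 (snd p)).
set (a := Cmod (fst p)) in *. set (b := Cmod (snd p)) in *.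
assert (a <= sqrt (a ^ 2 + b ^ 2)) by (rewrite <- (sqrt_pow2 a) at 1 by assumption; apply sqrt_le_1_alt; nra).
assert (b <= sqrt (a ^ 2 + b ^ 2)) by (rewrite <- (sqrt_pow2 b) at 1 by assumption; apply sqrt_le_1_alt; nra).
lra.
Qed.

Lemma norm_C2_axis (z : C) : @norm _ C2 (z, RtoC 0) = Cmod z /\ @norm _ C2 (RtoC 0, z) = Cmod z.
Proof.
rewrite !norm_C2. simpl fst; simpl snd. rewrite Cmod_0.
split; (transitivity (sqrt (Cmod z ^ 2)); [f_equal; ring|apply sqrt_pow2, Cmod_ge_0]).
Qed.

Lemma ex_filterdiff_separately (f : C2 -> C) (x y : C) :
  @ex_filterdiff C_AbsRing C2 C_NormedModule f (locally (x, y)) ->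
  (exists l, cdiff (fun u => f (u, y)) x l) /\ (exists l, cdiff (fun v => f (x, v)) y l).
Proof.
intros [lf [Hlin Hdom]]. 
assert (H : forall e, 0 < e -> exists d, 0 < d /\ forall q : C2, Cmod (fst q - x) < d -> Cmod (snd q - y) < d ->
   Cmod (f q - f (x, y) - lf (minus q ((x, y) : C2))) <= e * @norm _ C2 (minus q ((x, y) : C2))).
{ intros e He. specialize (Hdom (x, y) (fun P HP => HP) (mkposreal e He)).
  destruct (proj1 (locally_C2 _ _) Hdom) as (d & Hd & HH). exists d. split; [exact Hd|].
  intros q H1 H2. exact (HH q H1 H2). }
split.
- exists (lf (RtoC 1, RtoC 0)). intros e He. destruct (H e He) as (d & Hd & HH).
  exists d. split; [exact Hd|]. intros u Hu.
  specialize (HH (u, y) Hu). simpl fst in HH; simpl snd in HH.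
  replace (y - y)%C with (RtoC 0) in HH by ring. rewrite Cmod_0 in HH. specialize (HH Hd).
  replace (minus ((u, y) : C2) ((x, y) : C2)) with (((u - x)%C, RtoC 0) : C2) in HH.
  2:{ apply injective_projections; [reflexivity|]. change (RtoC 0 = y - y)%C. ring. }
  rewrite (proj1 (norm_C2_axis _)) in HH.
  replace (((u - x)%C, RtoC 0) : C2) with (@scal C_AbsRing C2 (u - x)%C (RtoC 1, RtoC 0)) in HH.
  2:{ apply injective_projections; [change ((u - x) * 1 = u - x)%C; ring|change ((u - x) * 0 = 0)%C; ring]. }
  rewrite (linear_scal _ Hlin) in HH. change (scal (u - x)%C (lf (RtoC 1, RtoC 0))) with ((u - x) * lf (RtoC 1, RtoC 0))%C in HH.
  rewrite (Cmult_comm (u - x)) in HH. exact HH.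
- exists (lf (RtoC 0, RtoC 1)). intros e He. destruct (H e He) as (d & Hd & HH).
  exists d. split; [exact Hd|]. intros u Hu.
  specialize (HH (x, u)). simpl fst in HH; simpl snd in HH.
  replace (x - x)%C with (RtoC 0) in HH by ring. rewrite Cmod_0 in HH. specialize (HH Hd Hu).
  replace (minus ((x, u) : C2) ((x, y) : C2)) with ((RtoC 0, (u - y)%C) : C2) in HH.
  2:{ apply injective_projections; [|reflexivity]. change (RtoC 0 = x - x)%C. ring. }
  rewrite (proj2 (norm_C2_axis _)) in HH.
  replace ((RtoC 0, (u - y)%C) : C2) with (@scal C_AbsRing C2 (u - y)%C (RtoC 0, RtoC 1)) in HH.
  2:{ apply injective_projections; [change ((u - y) * 0 = 0)%C; ring|change ((u - y) * 1 = u - y)%C; ring]. }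
  rewrite (linear_scal _ Hlin) in HH. change (scal (u - y)%C (lf (RtoC 0, RtoC 1))) with ((u - y) * lf (RtoC 0, RtoC 1))%C in HH.
  rewrite (Cmult_comm (u - y)) in HH. exact HH.
Qed.

Lemma holomorphic_germ_separately (f : C2 -> C) : holomorphic_germ f ->
  exists d M, 0 < d /\ forall x y, Cmod x < d -> Cmod y < d ->
    (exists l, cdiff (fun u => f (u, y)) x l) /\ (exists l, cdiff (fun v => f (x, v)) y l) /\ Cmod (f (x, y)) <= M.
Proof.
intros H. assert (H0 := locally_singleton _ _ H).
destruct (proj1 (locally_C2 _ _) H) as (d1 & Hd1 & HD).
assert (Hc := filterdiff_continuous _ _ H0).
assert (Hb : locally origin (fun p => Cmod (f p) <= Cmod (f origin) + 2)).
{ generalize (proj1 (filterlim_locally _ _) Hc (mkposreal 1 Rlt_0_1)). apply filter_imp.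
  intros p Hp. assert (B := C_NormedModule_mixin_compat2 _ _ _ Hp). simpl in B.
  change (Cmod (f p - f origin) < sqrt 2 * 1) in B. assert (E := sqrt2_le_2).
  replace (f p) with ((f p - f origin) + f origin)%C by ring.
  eapply Rle_trans; [apply Cmod_triangle|]. lra. }
destruct (proj1 (locally_C2 _ _) Hb) as (d2 & Hd2 & HB).
exists (Rmin d1 d2), (Cmod (f origin) + 2). split; [now apply Rmin_pos|].
intros x y Hx Hy.
assert (E : forall z, (z - fst origin = z)%C) by (intros z; simpl; ring).
assert (E' : forall z, (z - snd origin = z)%C) by (intros z; simpl; ring).
assert (m1 := Rmin_l d1 d2). assert (m2 := Rmin_r d1 d2).
destruct (ex_filterdiff_separately f x y) as [X1 X2].
{ apply HD; simpl fst; simpl snd; [rewrite E|rewrite E']; lra. }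
split; [exact X1|split; [exact X2|]].
apply (HB (x, y)); simpl fst; simpl snd; [rewrite E|rewrite E']; lra.
Qed.

(** [C_derive] is a limit along real increments, which determines the complex
    derivative when the latter exists. *)
Lemma cdiff_C_derive (f : C -> C) z l : cdiff f z l -> C_derive f z = l.
Proof.
intros H. apply is_C_derive_unique. split; [apply is_linear_scal_l|].
intros z' Hz' eps.
assert (Ez : z = z') by (apply (@is_filter_lim_locally_unique C_AbsRing (AbsRing_NormedModule C_AbsRing)); exact Hz').
subst z'.
destruct (H eps (cond_pos eps)) as (d & Hd & HH).
apply (@locally_le_locally_norm C_AbsRing (AbsRing_NormedModule C_AbsRing)).
exists (mkposreal d Hd). intros u Hu.
specialize (HH u Hu). change (Cmod (f u - f z - (u - z) * l) <= eps * Cmod (u - z)).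
rewrite (Cmult_comm (u - z)). exact HH.
Qed.

Section SecondOrder.
Variables (f fx fy : C2 -> C) (rho K : R).
Hypothesis Hrho : 0 < rho.
Hypothesis HK : 0 <= K.
Hypothesis second_order : forall p q : C2,
  Cmod (fst p) <= rho -> Cmod (snd p) <= rho -> Cmod (fst q) <= rho -> Cmod (snd q) <= rho ->
  Cmod (f q - f p - fx p * (fst q - fst p) - fy p * (snd q - snd p))
   <= K * (Cmod (fst q - fst p) + Cmod (snd q - snd p)) ^ 2.

Lemma stays_inside (x u : C) : Cmod x < rho -> Cmod (u - x) < rho - Cmod x -> Cmod u <= rho.
Proof.
intros H1 H2. replace u with ((u - x) + x)%C by ring. eapply Rle_trans; [apply Cmod_triangle|]. lra.
Qed.

Lemma second_order_cdiff (x y : C) : Cmod x < rho -> Cmod y < rho ->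
  cdiff (fun u => f (u, y)) x (fx (x, y)) /\ cdiff (fun v => f (x, v)) y (fy (x, y)).
Proof.
intros Hx Hy. split; intros e He.
- exists (Rmin (rho - Cmod x) (e / (K + 1))). split.
  { apply Rmin_pos; [lra|apply Rdiv_lt_0_compat; lra]. }
  intros u Hu. assert (h1 := Rlt_le_trans _ _ _ Hu (Rmin_l _ _)). assert (h2 := Rlt_le_trans _ _ _ Hu (Rmin_r _ _)).
  assert (S := second_order (x, y) (u, y)). simpl fst in S; simpl snd in S.
  replace (y - y)%C with (RtoC 0) in S by ring. rewrite Cmod_0, Rplus_0_r in S.
  replace (f (u, y) - f (x, y) - fx (x, y) * (u - x) - fy (x, y) * 0)%C with
    (f (u, y) - f (x, y) - fx (x, y) * (u - x))%C in S by ring.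
  eapply Rle_trans; [apply S; try lra; now apply (stays_inside x)|].
  assert (Hd := Cmod_ge_0 (u - x)).
  assert (e / (K + 1) * (K + 1) = e) by (field; lra).
  assert (K * Cmod (u - x) <= e) by nra. nra.
- exists (Rmin (rho - Cmod y) (e / (K + 1))). split.
  { apply Rmin_pos; [lra|apply Rdiv_lt_0_compat; lra]. }
  intros u Hu. assert (h1 := Rlt_le_trans _ _ _ Hu (Rmin_l _ _)). assert (h2 := Rlt_le_trans _ _ _ Hu (Rmin_r _ _)).
  assert (S := second_order (x, y) (x, u)). simpl fst in S; simpl snd in S.
  replace (x - x)%C with (RtoC 0) in S by ring. rewrite Cmod_0, Rplus_0_l in S.
  replace (f (x, u) - f (x, y) - fx (x, y) * 0 - fy (x, y) * (u - y))%C with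
    (f (x, u) - f (x, y) - fy (x, y) * (u - y))%C in S by ring.
  eapply Rle_trans; [apply S; try lra; now apply (stays_inside y)|].
  assert (Hd := Cmod_ge_0 (u - y)).
  assert (e / (K + 1) * (K + 1) = e) by (field; lra).
  assert (K * Cmod (u - y) <= e) by nra. nra.
Qed.

Lemma second_order_partials (p : C2) : Cmod (fst p) < rho -> Cmod (snd p) < rho ->
  partial_x f p = fx p /\ partial_y f p = fy p.
Proof.
destruct p as [x y]. intros Hx Hy. destruct (second_order_cdiff x y Hx Hy) as [H1 H2].
split; now apply cdiff_C_derive.
Qed.

Lemma second_order_holomorphic : holomorphic_germ f.
Proof.
apply locally_C2. exists rho. split; [exact Hrho|]. intros [x y]. simpl fst; simpl snd.
assert (Z : forall z : C, (z - 0 = z)%C) by (intros; ring). rewrite (Z x), (Z y). intros Hx Hy.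
exists (fun v : C2 => (fx (x, y) * fst v + fy (x, y) * snd v)%C). split.
- split.
  + intros [a b] [a' b']. change (fx (x, y) * (a + a') + fy (x, y) * (b + b') =
      fx (x, y) * a + fy (x, y) * b + (fx (x, y) * a' + fy (x, y) * b'))%C. ring.
  + intros k [a b]. change (fx (x, y) * (k * a) + fy (x, y) * (k * b) = k * (fx (x, y) * a + fy (x, y) * b))%C. ring.
  + set (m := Cmod (fx (x, y)) + Cmod (fy (x, y))).
    assert (H1 := Cmod_ge_0 (fx (x, y))). assert (H2 := Cmod_ge_0 (fy (x, y))).
    exists (2 * m + 1). split; [unfold m; lra|]. intros v.
    change (Cmod (fx (x, y) * fst v + fy (x, y) * snd v) <= (2 * m + 1) * norm v).
    eapply Rle_trans; [apply Cmod_triangle|]. rewrite !Cmod_mult.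
    assert (N := norm_C2_lower v). assert (N1 := Cmod_ge_0 (fst v)). assert (N2 := Cmod_ge_0 (snd v)).
    unfold m. nra.
- intros p Hp eps.
  assert (Ep : (x, y) = p) by (apply (@is_filter_lim_locally_unique C_AbsRing C2); exact Hp).
  subst p. apply locally_C2.
  set (d := Rmin (Rmin (rho - Cmod x) (rho - Cmod y)) (eps / (4 * (K + 1)))).
  assert (Heps := cond_pos eps).
  assert (Hd : 0 < d) by (apply Rmin_pos; [apply Rmin_pos; lra|apply Rdiv_lt_0_compat; lra]).
  assert (d <= rho - Cmod x /\ d <= rho - Cmod y /\ d <= eps / (4 * (K + 1))) as (D1 & D2 & D3).
  { unfold d. generalize (Rmin_l (Rmin (rho - Cmod x) (rho - Cmod y)) (eps / (4 * (K + 1))))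
     (Rmin_r (Rmin (rho - Cmod x) (rho - Cmod y)) (eps / (4 * (K + 1))))
     (Rmin_l (rho - Cmod x) (rho - Cmod y)) (Rmin_r (rho - Cmod x) (rho - Cmod y)). lra. }
  exists d. split; [exact Hd|]. intros [u v] Q1 Q2. simpl fst in Q1; simpl snd in Q2.
  assert (S := second_order (x, y) (u, v)). simpl fst in S; simpl snd in S.
  change (Cmod (f (u, v) - f (x, y) - (fx (x, y) * (u - x) + fy (x, y) * (v - y))) <= eps * @norm _ C2 (minus ((u, v) : C2) ((x, y) : C2))).
  assert (N := norm_C2_lower (minus ((u, v) : C2) ((x, y) : C2))).
  change (Cmod (u - x) + Cmod (v - y) <= 2 * @norm _ C2 (minus ((u, v) : C2) ((x, y) : C2))) in N.
  replace (f (u, v) - f (x, y) - (fx (x, y) * (u - x) + fy (x, y) * (v - y)))%C with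
    (f (u, v) - f (x, y) - fx (x, y) * (u - x) - fy (x, y) * (v - y))%C by ring.
  eapply Rle_trans; [apply S; try lra; [apply (stays_inside x)|apply (stays_inside y)]; lra|].
  assert (G1 := Cmod_ge_0 (u - x)). assert (G2 := Cmod_ge_0 (v - y)).
  set (s := Cmod (u - x) + Cmod (v - y)) in *.
  assert (eps / (4 * (K + 1)) * (4 * (K + 1)) = eps) by (field; lra).
  assert (s <= 2 * (eps / (4 * (K + 1)))) by (unfold s; lra).
  assert (0 < eps / (4 * (K + 1))) by (apply Rdiv_lt_0_compat; lra).
  set (E := eps / (4 * (K + 1))) in *.
  assert (K * s <= K * (2 * E)) by (apply Rmult_le_compat_l; assumption).
  assert (K * s <= eps / 2) by lra.
  assert (0 <= s) by (unfold s; lra).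
  replace (K * s ^ 2) with (K * s * s) by ring. nra.
Qed.
End SecondOrder.

(** * The Euler equation *)

(** The eigenvalue of [x d/dx + lambda y d/dy - (1 + lambda)] on [x^i y^j]. *)
Definition divisor (lambda : C) (i j : nat) : C := (INR i - 1 + lambda * (INR j - 1))%C.

Lemma nat_far_from_1 k : k <> 1%nat -> 1 <= Rabs (INR k - 1).
Proof.
intros Hk. destruct k as [|[|k]].
- simpl. rewrite Rabs_left; lra.
- now elim Hk.
- rewrite Rabs_pos_eq; rewrite !S_INR; generalize (pos_INR k); lra.
Qed.

(** For [j <> 1] the imaginary part is at least [|Im lambda|]; for [j = 1] the
    divisor is the nonzero integer [i - 1]. *)
Lemma divisor_lower_bound lambda i j : (i, j) <> (1%nat, 1%nat) ->
  Rmin 1 (Rabs (Im lambda)) <= Cmod (divisor lambda i j).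
Proof.
intros Hij.
assert (B := Rmax_Cmod (divisor lambda i j)).
assert (B1 := Rmax_l (Rabs (fst (divisor lambda i j))) (Rabs (snd (divisor lambda i j)))).
assert (B2 := Rmax_r (Rabs (fst (divisor lambda i j))) (Rabs (snd (divisor lambda i j)))).
destruct (Nat.eq_dec j 1) as [->|Hj].
- assert (Hi : i <> 1%nat) by (intros ->; now apply Hij).
  eapply Rle_trans; [apply Rmin_l|]. eapply Rle_trans; [apply (nat_far_from_1 i Hi)|].
  replace (INR i - 1) with (fst (divisor lambda i 1)) by (unfold divisor; simpl; ring). lra.
- eapply Rle_trans; [apply Rmin_r|].
  assert (E : snd (divisor lambda i j) = Im lambda * (INR j - 1)) by (unfold divisor, Im; simpl; ring).
  assert (B3 : Rabs (Im lambda) * Rabs (INR j - 1) <= Cmod (divisor lambda i j)) by (rewrite <- Rabs_mult, <- E; lra).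
  assert (H := nat_far_from_1 j Hj). assert (0 <= Rabs (Im lambda)) by apply Rabs_pos. nra.
Qed.

Lemma INR_le_pow2 k : INR k <= 2 ^ k.
Proof.
induction k as [|k IH]; [simpl; lra|]. rewrite S_INR. simpl.
assert (1 <= 2 ^ k) by (apply pow_R1_Rle; lra). lra.
Qed.

(** At the resonant index (1, 1) the divisor vanishes and any value would do. *)
Definition quotient_coef (lambda : C) (c : nat -> nat -> C) (i j : nat) : C :=
  match i, j with 1%nat, 1%nat => RtoC 0 | _, _ => (c i j / divisor lambda i j)%C end.

Lemma quotient_coef_spec lambda c i j : Im lambda <> 0 ->
  (divisor lambda i j * quotient_coef lambda c i j)%C =
  (c i j - match i, j with 1%nat, 1%nat => c 1%nat 1%nat | _, _ => RtoC 0 end)%C.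
Proof.
intros Hl.
assert (Hmu : 0 < Rmin 1 (Rabs (Im lambda))) by (apply Rmin_pos; [lra|now apply Rabs_pos_lt]).
assert (H : (i, j) <> (1%nat, 1%nat) -> (divisor lambda i j * (c i j / divisor lambda i j) = c i j - 0)%C).
{ intros Hij. assert (D := divisor_lower_bound lambda i j Hij).
  field. apply Cmod_gt_0. lra. }
destruct i as [|[|i]]; [apply H; discriminate| |apply H; discriminate].
destruct j as [|[|j]]; [apply H; discriminate| |apply H; discriminate].
simpl. ring.
Qed.

Lemma quotient_coef_bound lambda c i j K : Im lambda <> 0 -> 0 <= K -> Cmod (c i j) <= K ->
  Cmod (quotient_coef lambda c i j) <= K / Rmin 1 (Rabs (Im lambda)).
Proof.
intros Hl HK Hc.
assert (Hmu : 0 < Rmin 1 (Rabs (Im lambda))) by (apply Rmin_pos; [lra|now apply Rabs_pos_lt]).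
assert (H : (i, j) <> (1%nat, 1%nat) -> Cmod (c i j / divisor lambda i j) <= K / Rmin 1 (Rabs (Im lambda))).
{ intros Hij. assert (D := divisor_lower_bound lambda i j Hij).
  rewrite Cmod_div by (apply Cmod_gt_0; lra).
  apply Rmult_le_compat; [apply Cmod_ge_0|left; apply Rinv_0_lt_compat; lra|exact Hc|].
  apply Rinv_le_contravar; assumption. }
destruct i as [|[|i]]; [apply H; discriminate| |apply H; discriminate].
destruct j as [|[|j]]; [apply H; discriminate| |apply H; discriminate].
simpl. rewrite Cmod_0. apply Rmult_le_pos; [exact HK|left; now apply Rinv_0_lt_compat].
Qed.

(** [G] names [y dH/dy]: it is holomorphic because it is the power series with
    coefficients [j b_ij], so no theorem on derivatives of holomorphic functions
    of two variables is required. *)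
Lemma euler_equation (lambda : C) (F : C2 -> C) : Im lambda <> 0 -> holomorphic_germ F ->
  exists (alpha : C) (H G : C2 -> C), holomorphic_germ H /\ holomorphic_germ G /\
    locally origin (fun p => (snd p * partial_y H p)%C = G p /\
      (fst p * partial_x H p + lambda * (snd p * partial_y H p) - (1 + lambda) * H p)%C
        = (F p - alpha * (fst p * snd p))%C).
Proof.
intros Hl HF. destruct (holomorphic_germ_separately F HF) as (d & M & Hd & HD).
set (r := d / 8). assert (Hr : 0 < r) by (unfold r; lra).
assert (H4 : 4 * r < d) by (unfold r; lra).
set (F' := fun x y => F (x, y)).
assert (Hx : forall x y, Cmod x <= 4 * r -> Cmod y <= 4 * r -> exists l, cdiff (fun u => F' u y) x l)
  by (intros x y h1 h2; apply (HD x y); lra).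
assert (Hy : forall x y, Cmod x <= 4 * r -> Cmod y <= 4 * r -> exists l, cdiff (F' x) y l)
  by (intros x y h1 h2; apply (HD x y); lra).
assert (HM : forall x y, Cmod x <= 4 * r -> Cmod y <= 4 * r -> Cmod (F' x y) <= M)
  by (intros x y h1 h2; apply (HD x y); lra).
assert (HMp := bound_nonneg F' r M Hr HM).
set (c := cauchy_coef2 F' r). set (mu := Rmin 1 (Rabs (Im lambda))).
assert (Hmu : 0 < mu) by (apply Rmin_pos; [lra|now apply Rabs_pos_lt]).
(* The factor 2 in [A] makes room for the factor [j <= 2^j] in the
   coefficients [e]; [rho] is then the largest radius with [8 A rho <= 1]. *)
set (A := 2 / r). set (rho := r / 16). set (K := M / mu).
assert (HA : 0 <= A) by (left; apply Rdiv_lt_0_compat; lra).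
assert (Hrho : 0 < rho) by (unfold rho; lra).
assert (Hsmall : 8 * A * rho <= 1) by (unfold A, rho; right; field; lra).
assert (HK : 0 <= K) by (apply Rmult_le_pos; [lra|left; now apply Rinv_0_lt_compat]).
set (b := quotient_coef lambda c). set (e := fun i j => (INR j * b i j)%C).
assert (Hb0 : forall i j, Cmod (b i j) <= K * (/ r) ^ i * (/ r) ^ j).
{ intros i j. eapply Rle_trans; [apply (quotient_coef_bound lambda c i j (M * (/ r) ^ j * (/ r) ^ i) Hl)|].
  2: exact (cauchy_coef2_bound F' r M Hr Hx Hy HM i j).
  - repeat apply Rmult_le_pos; try apply pow_le; try lra; left; now apply Rinv_0_lt_compat.
  - right. unfold K. fold mu. field. lra. }
assert (HAr : forall k, A ^ k = 2 ^ k * (/ r) ^ k)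
  by (intros k; unfold A, Rdiv; apply Rpow_mult_distr).
assert (Hir : forall k, 0 <= (/ r) ^ k) by (intros k; apply pow_le; left; now apply Rinv_0_lt_compat).
assert (H2 : forall k, 1 <= 2 ^ k) by (intros k; apply pow_R1_Rle; lra).
assert (HirA : forall k, (/ r) ^ k <= A ^ k).
{ intros k. rewrite HAr. specialize (Hir k). specialize (H2 k). nra. }
assert (Hb : forall i j, Cmod (b i j) <= K * A ^ i * A ^ j).
{ intros i j. eapply Rle_trans; [apply Hb0|]. apply Rmult_le_compat; auto.
  - apply Rmult_le_pos; auto.
  - apply Rmult_le_compat_l; auto. }
assert (He : forall i j, Cmod (e i j) <= K * A ^ i * A ^ j).
{ intros i j. unfold e. rewrite Cmod_mult, Cmod_R, Rabs_pos_eq by apply pos_INR.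
  rewrite (HAr j). replace (K * A ^ i * (2 ^ j * (/ r) ^ j)) with (2 ^ j * (K * A ^ i * (/ r) ^ j)) by ring.
  apply Rmult_le_compat; [apply pos_INR|apply Cmod_ge_0|apply INR_le_pow2|].
  eapply Rle_trans; [apply Hb0|]. apply Rmult_le_compat_r; auto. apply Rmult_le_compat_l; auto. }
assert (SO : forall p q : C2, Cmod (fst p) <= rho -> Cmod (snd p) <= rho -> Cmod (fst q) <= rho -> Cmod (snd q) <= rho ->
   Cmod (psum b q - psum b p - psum_x b p * (fst q - fst p) - psum_y b p * (snd q - snd p))
   <= 4 * K / rho ^ 2 * (Cmod (fst q - fst p) + Cmod (snd q - snd p)) ^ 2).
{ intros p q h1 h2 h3 h4. apply (psum_second_order b K A rho HK HA Hrho Hsmall Hb p q); split; assumption. }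
assert (SO' : forall p q : C2, Cmod (fst p) <= rho -> Cmod (snd p) <= rho -> Cmod (fst q) <= rho -> Cmod (snd q) <= rho ->
   Cmod (psum e q - psum e p - psum_x e p * (fst q - fst p) - psum_y e p * (snd q - snd p))
   <= 4 * K / rho ^ 2 * (Cmod (fst q - fst p) + Cmod (snd q - snd p)) ^ 2).
{ intros p q h1 h2 h3 h4. apply (psum_second_order e K A rho HK HA Hrho Hsmall He p q); split; assumption. }
assert (HC : 0 <= 4 * K / rho ^ 2).
{ apply Rmult_le_pos; [lra|]. left. apply Rinv_0_lt_compat, pow_lt, Hrho. }
exists (c 1%nat 1%nat), (psum b), (psum e).
split; [exact (second_order_holomorphic _ _ _ rho _ Hrho HC SO)|].
split; [exact (second_order_holomorphic _ _ _ rho _ Hrho HC SO')|].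
apply locally_C2. exists rho. split; [exact Hrho|]. intros [x y]. simpl fst; simpl snd.
assert (Z : forall z : C, (z - 0 = z)%C) by (intros; ring). rewrite (Z x), (Z y). intros Ex Ey.
destruct (second_order_partials _ _ _ rho _ HC SO (x, y) Ex Ey) as [-> ->].
assert (Hp : in_polydisc rho (x, y)) by (split; simpl; lra).
assert (L := psum_clim b K A rho HK HA Hrho Hsmall Hb (x, y) Hp).
assert (Lx := clim_mult x _ _ (psum_x_clim b K A rho HK HA Hrho Hsmall Hb (x, y) Hp)).
assert (Ly := clim_mult y _ _ (psum_y_clim b K A rho HK HA Hrho Hsmall Hb (x, y) Hp)).
assert (Le := psum_clim e K A rho HK HA Hrho Hsmall He (x, y) Hp).
simpl fst in *; simpl snd in *.
split.
{ apply (clim_unique (square_sum (fun i j => (e i j * (x ^ i * y ^ j))%C))); [|exact Le].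
  apply (clim_ext 0 (fun n => (y * square_sum (fun i j => (b i j * (x ^ i * dpow y j))%C) n)%C)); [|exact Ly].
  intros n _. rewrite <- square_sum_mult. apply square_sum_ext. intros i j. unfold e.
  replace (INR j * b i j * (x ^ i * y ^ j))%C with (b i j * x ^ i * (INR j * y ^ j))%C by ring.
  rewrite <- dpow_euler. ring. }
assert (LF : clim (square_sum (fun i j => (c i j * (x ^ i * y ^ j))%C)) (F (x, y))).
{ intros eps Heps. destruct (half_pow_small (12 * M) eps Heps) as [N HN]. exists N. intros n Hn.
  eapply Rle_lt_trans; [|apply (HN n Hn)].
  replace (square_sum (fun i j => (c i j * (x ^ i * y ^ j))%C) n - F (x, y))%C with
    (- (F' x y - square_sum (fun i j => (c i j * x ^ i * y ^ j)%C) n))%C.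
  - rewrite Cmod_opp. apply (square_sum_approx F' r M Hr Hx Hy HM); unfold rho in *; lra.
  - rewrite (square_sum_ext (fun i j => (c i j * x ^ i * y ^ j)%C) (fun i j => (c i j * (x ^ i * y ^ j))%C)).
    + unfold F'. ring.
    + intros i j. ring. }
apply (clim_unique (square_sum (fun i j => (divisor lambda i j * b i j * (x ^ i * y ^ j))%C))).
- apply (clim_ext 0 (fun n => (x * square_sum (fun i j => (b i j * (dpow x i * y ^ j))%C) n
    + lambda * (y * square_sum (fun i j => (b i j * (x ^ i * dpow y j))%C) n)
    - (1 + lambda) * square_sum (fun i j => (b i j * (x ^ i * y ^ j))%C) n)%C)).
  + intros n _. rewrite <- !square_sum_mult, <- square_sum_plus, <- square_sum_minus.
    apply square_sum_ext. intros i j.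
    replace (x * (b i j * (dpow x i * y ^ j)))%C with (b i j * y ^ j * (x * dpow x i))%C by ring.
    replace (lambda * (y * (b i j * (x ^ i * dpow y j))))%C with (lambda * b i j * x ^ i * (y * dpow y j))%C by ring.
    rewrite !dpow_euler. unfold divisor. ring.
  + apply clim_minus; [apply clim_plus; [exact Lx|now apply clim_mult]|now apply clim_mult].
- apply (clim_ext 2 (fun n => (square_sum (fun i j => (c i j * (x ^ i * y ^ j))%C) n - c 1%nat 1%nat * (x * y))%C)).
  + intros n Hn. destruct n as [|[|n]]; [lia|lia|].
    rewrite <- (square_sum_corner (c 1%nat 1%nat * (x * y))%C n), <- square_sum_minus.
    apply square_sum_ext. intros i j. unfold b. rewrite (quotient_coef_spec lambda c i j Hl).
    destruct i as [|[|i]]; [simpl; ring| |simpl; ring].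
    destruct j as [|[|j]]; simpl; ring.
  + apply clim_minus; [exact LF|apply clim_const].
Qed.

Local Open Scope C_scope.

(** * Meromorphic forms *)

Lemma holomorphic_const (c : C) : holomorphic_germ (fun _ => c).
Proof. unfold holomorphic_germ. apply filter_forall. intros p. eexists. apply filterdiff_const. Qed.

Lemma holomorphic_fst : holomorphic_germ (fun p => fst p).
Proof. unfold holomorphic_germ. apply filter_forall. intros p. eexists. apply filterdiff_linear, is_linear_fst. Qed.

Lemma holomorphic_snd : holomorphic_germ (fun p => snd p).
Proof. unfold holomorphic_germ. apply filter_forall. intros p. eexists. apply filterdiff_linear, is_linear_snd. Qed.

Lemma holomorphic_plus f g : holomorphic_germ f -> holomorphic_germ g ->
  holomorphic_germ (fun p => f p + g p).
Proof.
unfold holomorphic_germ. intros Hf Hg. generalize (filter_and _ _ Hf Hg). apply filter_imp. intros p [[lf H1] [lg H2]].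
eexists. exact (filterdiff_plus_fct f g lf lg H1 H2).
Qed.

(** [C] carries two normed module structures over itself with the same norm
    but different uniform structures; differentials are moved between them. *)
Lemma filterdiff_C_module (f : C2 -> C) (F : (C2 -> Prop) -> Prop) (l : C2 -> C) :
  @filterdiff C_AbsRing C2 C_NormedModule f F l <->
  @filterdiff C_AbsRing C2 (AbsRing_NormedModule C_AbsRing) f F l.
Proof.
split; intros [[l1 l2 l3] H]; (split; [split; assumption|exact H]).
Qed.

Lemma holomorphic_mult f g : holomorphic_germ f -> holomorphic_germ g ->
  holomorphic_germ (fun p => f p * g p).
Proof.
unfold holomorphic_germ. intros Hf Hg. generalize (filter_and _ _ Hf Hg). apply filter_imp. intros p [[lf H1] [lg H2]].
eexists. apply filterdiff_C_module.
apply (@filterdiff_mult_fct C_AbsRing C2 f g p lf lg Cmult_comm); now apply filterdiff_C_module.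
Qed.

Lemma holomorphic_opp f : holomorphic_germ f -> holomorphic_germ (fun p => - f p).
Proof.
unfold holomorphic_germ. intros Hf. generalize Hf. apply filter_imp. intros p [lf H1].
eexists. exact (filterdiff_opp_fct f lf H1).
Qed.

Lemma xy_not_zero_germ : ~ germ_eq (fun p => fst p * snd p) (fun _ => RtoC 0).
Proof.
intros H. destruct (proj1 (locally_C2 _ _) H) as (d & Hd & HH).
assert (E : Cmod (RtoC (d / 2) - 0) = (d / 2)%R).
{ replace (RtoC (d / 2) - 0) with (RtoC (d / 2)) by ring. rewrite Cmod_R, Rabs_pos_eq; lra. }
specialize (HH (RtoC (d / 2), RtoC (d / 2))). simpl fst in HH; simpl snd in HH.
rewrite E in HH. specialize (HH ltac:(lra) ltac:(lra)).
rewrite <- RtoC_mult in HH. apply RtoC_inj in HH. nra.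
Qed.

Lemma partial_xy (p : C2) : partial_x (fun q => fst q * snd q) p = snd p /\ partial_y (fun q => fst q * snd q) p = fst p.
Proof.
destruct p as [x y].
split; apply cdiff_C_derive; intros e He; exists 1%R; (split; [lra|]); intros u _; simpl fst; simpl snd.
- replace (u * y - x * y - y * (u - x)) with (RtoC 0) by ring.
  rewrite Cmod_0. apply Rmult_le_pos; [lra|apply Cmod_ge_0].
- replace (x * u - x * y - x * (u - y)) with (RtoC 0) by ring.
  rewrite Cmod_0. apply Rmult_le_pos; [lra|apply Cmod_ge_0].
Qed.

Lemma over_xy_meromorphic f : holomorphic_germ f ->
  meromorphic (Frac f (fun p => fst p * snd p)).
Proof.
intros Hf. split; [exact Hf|split; [|exact xy_not_zero_germ]].
exact (holomorphic_mult _ _ holomorphic_fst holomorphic_snd).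
Qed.

Lemma over_xy_in_O2 f : holomorphic_germ f ->
  in_O2 (frac_x * frac_y * Frac f (fun p => (fst p * snd p)%C))%frac.
Proof.
intros Hf. exists f. split; [exact Hf|]. unfold frac_eq, germ_eq. apply filter_forall. intros p. simpl. ring.
Qed.

(** Reduces an equality of fractions to a polynomial identity without unfolding
    the module structure of [C2], so that all occurrences of a coordinate remain
    syntactically equal. *)
Tactic Notation "unfold_fractions" :=
  cbn [num den coef_dx coef_dy frac_of frac_const frac_x frac_y frac_add frac_opp frac_sub frac_mul
    frac_inv frac_dx frac_dy form_add form_sub form_scal dlog_x dlog_y differential wedge omega0].
Tactic Notation "unfold_fractions" "in" hyp(E) :=
  cbn [num den coef_dx coef_dy frac_of frac_const frac_x frac_y frac_add frac_opp frac_sub frac_mul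
    frac_inv frac_dx frac_dy form_add form_sub form_scal dlog_x dlog_y differential wedge omega0] in E.

Theorem theoremA (lambda : C) (lambda_nonreal : Im lambda <> 0%R)
  (lambda_dioph : positive_cone_diophantine lambda)
  (eta : mform) (eta_mero : meromorphic_form eta)
  (eta_log : holomorphic_form ((frac_x * frac_y)%frac *: eta)%form) :
  exists (alpha beta : C) (h : frac),
    meromorphic h /\
    in_O2 (frac_x * frac_y * h)%frac /\
    (wedge (eta - frac_const alpha *: dlog_x - frac_const beta *: dlog_y)%form
           (omega0 lambda)
     == wedge (differential h) (omega0 lambda))%frac /\
    exists a : frac,
      meromorphic a /\
      in_O2 (frac_x * frac_y * a)%frac /\
      (eta == a *: omega0 lambda + frac_const alpha *: dlog_x
              + frac_const beta *: dlog_y + differential h)%form.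
Proof.
destruct eta as [[n1 d1] [n2 d2]].
destruct eta_log as [[A [HA EA]] [B [HB EB]]]. 
assert (HF : holomorphic_germ (fun p => fst p * A p + lambda * (snd p * B p))).
{ apply holomorphic_plus; [apply (holomorphic_mult _ _ holomorphic_fst HA)|].
  apply (holomorphic_mult (fun _ => lambda)); [apply holomorphic_const|].
  apply (holomorphic_mult _ _ holomorphic_snd HB). }
destruct (euler_equation lambda _ lambda_nonreal HF) as (alpha & H & G & HH & HG & HE).
assert (HN : holomorphic_germ (fun p => snd p * B p + - G p + H p)).
{ apply (holomorphic_plus (fun p => snd p * B p + - G p)); [|exact HH].
  apply (holomorphic_plus (fun p => snd p * B p)); [|now apply holomorphic_opp].
  apply (holomorphic_mult _ _ holomorphic_snd HB). }
assert (HP : locally origin (fun p : C2 =>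
   fst p * snd p * n1 p - A p * d1 p = 0 /\ fst p * snd p * n2 p - B p * d2 p = 0 /\
   snd p * partial_y H p = G p /\
   fst p * partial_x H p + lambda * (snd p * partial_y H p) - (1 + lambda) * H p
     - (fst p * A p + lambda * (snd p * B p) - alpha * (fst p * snd p)) = 0)).
{ generalize (filter_and _ _ EA (filter_and _ _ EB HE)). apply filter_imp.
  intros p (E1 & E2 & E3 & E4). unfold_fractions in E1. unfold_fractions in E2. repeat split.
  - transitivity (fst p * snd p * n1 p * 1 - A p * d1 p); [ring|]. rewrite E1. ring.
  - transitivity (fst p * snd p * n2 p * 1 - B p * d2 p); [ring|]. rewrite E2. ring.
  - exact E3.
  - rewrite E4. ring. }
clear EA EB HE.
exists alpha, (RtoC 0), (Frac H (fun p => fst p * snd p)).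
split; [now apply over_xy_meromorphic|split; [now apply over_xy_in_O2|split]].
- revert HP. unfold frac_eq, germ_eq. apply filter_imp. intros p (E1 & E2 & E3 & E4).
  unfold_fractions. destruct (partial_xy p) as [-> ->].
  set (x := fst p) in *. set (y := snd p) in *.
  (* The sides agree modulo the three relations; the cofactors are the common
     denominator [d1 d2 x^7 y^7] divided by [d1 x y^2], [d2 x^2 y], [x^2 y^2]. *)
  match goal with |- ?l = ?r => transitivity (r + d2 p * x ^ 6 * y ^ 5 * (x * y * n1 p - A p * d1 p)
     + lambda * d1 p * x ^ 5 * y ^ 6 * (x * y * n2 p - B p * d2 p)
     - d1 p * d2 p * x ^ 5 * y ^ 5 * (x * partial_x H p + lambda * (y * partial_y H p) - (1 + lambda) * H p
     - (x * A p + lambda * (y * B p) - alpha * (x * y)))) end.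
  + ring.
  + rewrite E1, E2, E4. ring.
- exists (Frac (fun p => snd p * B p + - G p + H p) (fun p => fst p * snd p)).
  split; [now apply over_xy_meromorphic|split; [now apply over_xy_in_O2|split]].
  + revert HP. unfold frac_eq, germ_eq. apply filter_imp. intros p (E1 & E2 & E3 & E4).
    unfold_fractions. destruct (partial_xy p) as [-> _]. rewrite <- E3.
    set (x := fst p) in *. set (y := snd p) in *.
    match goal with |- ?l = ?r => transitivity (r + x ^ 4 * y ^ 2 * (x * y * n1 p - A p * d1 p)
       - d1 p * x ^ 3 * y ^ 2 * (x * partial_x H p + lambda * (y * partial_y H p) - (1 + lambda) * H p
       - (x * A p + lambda * (y * B p) - alpha * (x * y)))) end.
    * ring.
    * rewrite E1, E4. ring.
  + revert HP. unfold frac_eq, germ_eq. apply filter_imp. intros p (E1 & E2 & E3 & E4).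
    unfold_fractions. destruct (partial_xy p) as [_ ->]. rewrite <- E3.
    set (x := fst p) in *. set (y := snd p) in *.
    match goal with |- ?l = ?r => transitivity (r + x ^ 2 * y ^ 4 * (x * y * n2 p - B p * d2 p)) end.
    * ring.
    * rewrite E2. ring.
Qed.
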